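(* If $G$ is a finitely generated torsion free nilpotent group and the Lie algebra $L(G)$ over $\mathbb{Q}$ is characteristically nilpotent, then $G$ is co-Hopfian.
   Context: A group is co-Hopfian if it contains no proper subgroup isomorphic to itself. By Mal'cev, any finitely generated torsion free nilpotent group $G$ is isomorphic to a cocompact discrete subgroup of a simply-connected nilpotent Lie group $N_G$, which is unique up to isomorphism; we regard $G$ as a subgroup of $N_G$. The exponential map $\exp$ from the Lie algebra of $N_G$ to $N_G$ is a diffeomorphism with inverse $\log$. The $\mathbb{Q}$-span of $\log(G)$ is a finite-dimensional nilpotent Lie algebra over $\mathbb{Q}$, denoted $L(G)$. A Lie algebra $L$ is characteristically nilpotent if each derivation of $L$ is a nilpotent endomorphism. *)

(* Defs.v *)
From HB Require Import structures.
From mathcomp Require Import all_boot all_order all_algebra.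
From mathcomp Require Import generic_quotient.
From mathcomp Require Import all_classical all_reals all_analysis.

Set Implicit Arguments.
Unset Strict Implicit.
Unset Printing Implicit Defensive.

Import Order.TTheory GRing.Theory Num.Theory.
Import numFieldNormedType.Exports.

Local Open Scope classical_set_scope.
Local Open Scope ring_scope.

Notation group_hom := UMagmaMorphism.type.

Section AbstractGroups.
Variable G : groupType.
Implicit Types H S : set G.

Definition is_subgroup H : Prop :=
  [/\ H 1%g, forall x y, H x -> H y -> H (x * y)%g & forall x, H x -> H (x^-1)%g].

Definition generated_by S : set G :=
  [set x | forall H, is_subgroup H -> S `<=` H -> H x].

Definition finitely_generated : Prop :=
  exists s : seq G, generated_by [set` s] = setT.

Definition torsion_free : Prop :=
  forall (x : G) (n : nat), (0 < n)%N -> (x ^+ n)%g = 1%g -> x = 1%g.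

Fixpoint lower_central (n : nat) : set G :=
  if n is m.+1 then
    generated_by [set z | exists x y, lower_central m x /\ z = [~ x, y]%g]
  else setT.

Definition nilpotent_group : Prop := exists n, lower_central n = [set 1%g].

Definition isomorphic_to_subgroup H : Prop :=
  exists f : group_hom G G, injective f /\ range f = H.

Definition co_hopfian : Prop :=
  forall H, is_subgroup H -> isomorphic_to_subgroup H -> H = setT.

End AbstractGroups.

Section LieAlgebras.
Variables (F : fieldType) (V : lmodType F) (br : V -> V -> V).

Definition is_lie_bracket : Prop :=
  [/\ forall a x y z, br (a *: x + y) z = a *: br x z + br y z,
      forall a x y z, br z (a *: x + y) = a *: br z x + br z y,
      forall x, br x x = 0
    & forall x y z, br x (br y z) + br y (br z x) + br z (br x y) = 0].

(* [:: x1; ...; xn] |-> [x1, [x2, ... [x_(n-1), xn]]] *)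
Fixpoint iter_bracket (s : seq V) : V :=
  match s with
  | [::] => 0
  | [:: x] => x
  | x :: s' => br x (iter_bracket s')
  end.

(* Right-nested brackets of length c.+1 span the c-th term of the lower
   central series, so this says that the nilpotency class is at most c. *)
Definition lie_nilpotent (c : nat) : Prop :=
  forall s : seq V, size s = c.+1 -> iter_bracket s = 0.

(* Dynkin's form of the Baker-Campbell-Hausdorff series log (exp x exp y):
     \sum_(k >= 1) (-1)^(k-1) / k  \sum_((r_i, s_i) <> (0, 0))
        [x^r_1 y^s_1 ... x^r_k y^s_k]
          / ((\sum_i (r_i + s_i)) \prod_i r_i! s_i!).
   When lie_nilpotent c holds, the brackets of length > c vanish, so the sum
   may be restricted to k, r_i, s_i <= c. *)
Definition bch (c : nat) (x y : V) : V :=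
  \sum_(1 <= k < c.+1) ((-1) ^+ k.-1 / k%:R) *:
    \sum_(f : {ffun 'I_k -> 'I_c.+1 * 'I_c.+1} |
          [forall i, 0 < (f i).1 + (f i).2]%N)
      ((\sum_i ((f i).1 + (f i).2))%N%:R *
       (\prod_i ((f i).1`! * (f i).2`!))%N%:R)^-1 *:
      iter_bracket
        (flatten [seq nseq (f i).1 x ++ nseq (f i).2 y | i <- enum 'I_k]).

End LieAlgebras.

HB.structure Definition GroupWithTopology := {T of Group T & Topological T}.

(* A simply-connected nilpotent Lie group: its Lie algebra is a nilpotent Lie
   algebra structure on R^d, the exponential map is a homeomorphism (and the
   smooth structure is the one it transports from R^d), and the group law is
   given in exponential coordinates by the Baker-Campbell-Hausdorff formula.
   That formula is polynomial, so the group operations are then smooth. *)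
Record sc_nilpotent_lie_group (R : realType) := SCNilpotentLieGroup {
  lg_carrier :> GroupWithTopology.type;
  lg_dim : nat;
  lg_bracket : 'rV[R]_lg_dim -> 'rV[R]_lg_dim -> 'rV[R]_lg_dim;
  lg_bracketP : is_lie_bracket lg_bracket;
  lg_class : nat;
  lg_nilpotent : lie_nilpotent lg_bracket lg_class;
  lg_exp : 'rV[R]_lg_dim -> lg_carrier;
  lg_log : lg_carrier -> 'rV[R]_lg_dim;
  lg_expK : cancel lg_exp lg_log;
  lg_logK : cancel lg_log lg_exp;
  lg_exp_continuous : continuous lg_exp;
  lg_log_continuous : continuous lg_log;
  lg_exp_bch : forall x y,
    (lg_exp x * lg_exp y)%g = lg_exp (bch lg_bracket lg_class x y)
}.

Section CocompactDiscrete.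
Variables (G : groupType) (N : GroupWithTopology.type).
Variable iota : group_hom G N.

Definition discrete_image : Prop :=
  forall g : G, exists2 U : set N,
    nbhs (iota g) U & U `&` range iota = [set iota g].

Definition coset_rel : rel N := fun x y => `[< range iota (x^-1 * y)%g >].

Lemma coset_rel_equiv : equiv_class_of coset_rel.
Proof.
split=> [x|x y|y x z].
- by apply/asboolP; exists 1%g => //; rewrite gmulf1 mulVg.
- by apply/asboolP/asboolP => -[g _ gE]; exists (g^-1)%g => //;
    rewrite gmulfV gE invgM invgK.
- move=> /asboolP[g _ gE] /asboolP[h _ hE]; apply/asboolP.
  by exists (g * h)%g => //; rewrite gmulfM gE hE mulgA mulgK.
Qed.

Canonical coset_equiv := EquivRelPack coset_rel_equiv.

Definition cocompact_image : Prop :=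
  compact [set: quotient_topology {eq_quot coset_equiv}%qT].

End CocompactDiscrete.

Section RationalLieAlgebra.
Variables (R : realType) (V : lmodType R) (br : V -> V -> V).

Definition rat_span (S : set V) : set V :=
  [set v | exists (k : nat) (q : 'I_k -> rat) (x : 'I_k -> V),
     (forall i, S (x i)) /\ v = \sum_(i < k) ratr (q i) *: x i].

(* Derivations of the Lie algebra over rat carried by the subset L of V, as
   maps V -> V whose values outside L are irrelevant. *)
Definition rat_derivation (L : set V) (D : V -> V) : Prop :=
  [/\ forall x, L x -> L (D x),
      forall x y, L x -> L y -> D (x + y) = D x + D y,
      forall (q : rat) x, L x -> D (ratr q *: x) = ratr q *: D x
    & forall x y, L x -> L y -> D (br x y) = br (D x) y + br x (D y)].

Definition characteristically_nilpotent (L : set V) : Prop :=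
  forall D, rat_derivation L D -> exists k, forall x, L x -> iter k D x = 0.

End RationalLieAlgebra.

Definition malcev_lie (R : realType) (G : groupType)
    (N : sc_nilpotent_lie_group R) (iota : group_hom G N) :
    set 'rV[R]_(lg_dim N) :=
  rat_span (@lg_log R N @` range iota).

(* Main.v *)
(* Let L be the rational Lie algebra of G.  An injective endomorphism f of G
   extends to an automorphism phi of L.  Indeed, by Mal'cev every element of the
   Lie algebra generated by the logarithms of a group is a rational multiple of
   such a logarithm; applied to the graph of f, this shows that the rational span
   of the pairs (log g, log f(g)) is the graph of an injective map.

   A map t from the eigenvalues of phi to the rationals with t(a) + t(b) = t(ab)
   yields a derivation of the complexified L acting as t(a) on the generalized
   eigenspace of a.  Rational derivations being nilpotent, the trace form
   vanishes on derivations, so the sum of the t(a)^2, weighted by dimensions, is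
   0 and t = 0.  As no nonzero t exists, the eigenvalues are roots of unity,
   and a power phi^N is unipotent.

   Finally L has a filtration with central layers on which phi^N acts trivially,
   so that g^-1 f^N(g) always lies one layer deeper than g; descending the
   filtration, f^N and hence f is surjective. *)

Require Import Defs.
From HB Require Import structures.
From mathcomp Require Import all_boot all_order all_algebra all_field.
From mathcomp Require Import all_classical all_reals all_analysis.

Set Implicit Arguments.
Unset Strict Implicit.
Unset Printing Implicit Defensive.

Import Order.TTheory GRing.Theory Num.Theory.

Local Open Scope classical_set_scope.
Local Open Scope ring_scope.

(** * Bilinear maps *)

Section Bilinear.
Variables (F : fieldType) (V : lmodType F) (B : V -> V -> V).
Hypothesis Bl : forall a x y z, B (a *: x + y) z = a *: B x z + B y z.
Hypothesis Br : forall a x y z, B z (a *: x + y) = a *: B z x + B z y.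

Lemma bilDl x y z : B (x + y) z = B x z + B y z.
Proof. by have := Bl 1 x y z; rewrite !scale1r. Qed.

Lemma bilDr z x y : B z (x + y) = B z x + B z y.
Proof. by have := Br 1 x y z; rewrite !scale1r. Qed.

Lemma bil0l z : B 0 z = 0.
Proof. by apply: (addrI (B 0 z)); rewrite -bilDl !addr0. Qed.

Lemma bil0r z : B z 0 = 0.
Proof. by apply: (addrI (B z 0)); rewrite -bilDr !addr0. Qed.

Lemma bilZl a x z : B (a *: x) z = a *: B x z.
Proof. by have := Bl a x 0 z; rewrite !addr0 bil0l addr0. Qed.

Lemma bilZr a z x : B z (a *: x) = a *: B z x.
Proof. by have := Br a x 0 z; rewrite !addr0 bil0r addr0. Qed.

Lemma bil_suml I (r : seq I) (P : pred I) E z :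
  B (\sum_(i <- r | P i) E i) z = \sum_(i <- r | P i) B (E i) z.
Proof. exact: (big_morph (B^~ z) (fun x y => bilDl x y z) (bil0l z)). Qed.

Lemma bil_sumr I (r : seq I) (P : pred I) E z :
  B z (\sum_(i <- r | P i) E i) = \sum_(i <- r | P i) B z (E i).
Proof. exact: (big_morph (B z) (bilDr z) (bil0r z)). Qed.

End Bilinear.

(** * Rational subspaces and rational linear maps *)

Section RationalSubspaces.
Variables (F : numFieldType) (V : lmodType F).

(** Rational scalars act through [ratr], as the Lie algebra of the group is a rational subspace of a
    real vector space. *)
Definition rat_subspace (P : set V) : Prop :=
  P 0 /\ forall (q : rat) x y, P x -> P y -> P (ratr q *: x + y).

Variable P : set V.
Hypothesis Psub : rat_subspace P.

Lemma rat_subspace0 : P 0.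
Proof. by case: Psub. Qed.

Lemma rat_subspaceZ q x : P x -> P (ratr q *: x).
Proof. by case: Psub => P0 PL Px; rewrite -[_ *: x]addr0; apply: PL. Qed.

Lemma rat_subspaceD x y : P x -> P y -> P (x + y).
Proof.
by case: Psub => P0 PL Px Py; rewrite -[x]scale1r -(rmorph1 (@ratr F)); apply: PL.
Qed.

Lemma rat_subspaceN x : P x -> P (- x).
Proof. by move=> Px; rewrite -scaleN1r -(rmorphN1 (@ratr F)); apply: rat_subspaceZ. Qed.

Lemma rat_subspaceB x y : P x -> P y -> P (x - y).
Proof. by move=> Px /rat_subspaceN; apply: rat_subspaceD. Qed.

Lemma rat_subspaceMn x n : P x -> P (x *+ n).
Proof.
by move=> Px; rewrite -scaler_nat -(ratr_nat F); apply: rat_subspaceZ.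
Qed.

Lemma rat_subspace_sum I (r : seq I) (Q : pred I) (E : I -> V) :
  (forall i, Q i -> P (E i)) -> P (\sum_(i <- r | Q i) E i).
Proof.
by move=> PE; elim/big_ind: _ => //; [apply: rat_subspace0 | apply: rat_subspaceD].
Qed.

End RationalSubspaces.

Section RationalLinear.
Variables (F : numFieldType) (V : lmodType F) (m : nat) (T : 'rV[rat]_m -> V).
Hypothesis Tlin : forall q u v, T (q *: u + v) = ratr q *: T u + T v.

Lemma rat_linearD u v : T (u + v) = T u + T v.
Proof. by have := Tlin 1 u v; rewrite rmorph1 !scale1r. Qed.

Lemma rat_linear0 : T 0 = 0.
Proof. by apply: (addrI (T 0)); rewrite -rat_linearD !addr0. Qed.

Lemma rat_linearZ q u : T (q *: u) = ratr q *: T u.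
Proof. by have := Tlin q u 0; rewrite rat_linear0 !addr0. Qed.

Lemma rat_linearB u v : T (u - v) = T u - T v.
Proof. by rewrite rat_linearD -[- v]scaleN1r rat_linearZ rmorphN1 scaleN1r. Qed.

End RationalLinear.

(** * Rational coordinates and rational spans *)

Section Coordinates.
Variables (F : numFieldType) (V : lmodType F).

(** By induction on [X]: a new vector either already lies in the image of [T] or becomes one more
    coordinate. The last clause makes that image the least rational subspace containing [X]. *)
Lemma rat_coordinates (X : seq V) :
  exists m, exists T : 'rV[rat]_m -> V,
  [/\ forall q u v, T (q *: u + v) = ratr q *: T u + T v,
      injective T,
      forall x, x \in X -> exists u, T u = x
    & forall P : set V, rat_subspace P -> (forall x, x \in X -> P x) ->
        forall u, P (T u)].
Proof.
elim: X => [|x X [m [T [Tlin Tinj TX Tmin]]]].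
  exists 0%N, (fun=> 0); split=> // [q u v|u v _|P Psub _ _].
  - by rewrite scaler0 addr0.
  - by apply/rowP => -[].
  - exact: rat_subspace0.
have T0 := rat_linear0 Tlin; have TB := rat_linearB Tlin.
have TZ := rat_linearZ Tlin.
have [[u ux]|nx] := pselect (exists u, T u = x).
  exists m, T; split=> // [y|P Psub PX].
    by rewrite inE => /orP[/eqP ->|/TX //]; exists u.
  by apply: Tmin => // y yX; apply: PX; rewrite inE yX orbT.
exists (1 + m)%N, (fun u : 'rV[rat]_(1 + m) => ratr (lsubmx u 0 0) *: x + T (rsubmx u)); split.
- move=> q u v; rewrite !mxE rmorphD rmorphM scalerDl -scalerA scalerDr addrACA.
  congr (_ + _); rewrite -Tlin; congr T.
  by apply/matrixP => i j; rewrite !mxE.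
- move=> u v uv; have uv0 : lsubmx u 0 0 = lsubmx v 0 0.
    (* If the first coordinates differed, division by their difference would put [x] in the image of
       [T]. *)
    apply/eqP/negPn/negP; rewrite -subr_eq0 => q0.
    apply: nx; exists ((lsubmx u 0 0 - lsubmx v 0 0)^-1 *: (rsubmx v - rsubmx u)).
    rewrite TZ TB.
    have -> : T (rsubmx v) - T (rsubmx u) = ratr (lsubmx u 0 0 - lsubmx v 0 0) *: x.
      by apply/eqP; rewrite rmorphB scalerBl subr_eq addrAC uv addrC addKr.
    by rewrite scalerA -rmorphM mulVf // rmorph1 scale1r.
  have /Tinj uvr : T (rsubmx u) = T (rsubmx v) by move: uv; rewrite uv0 => /addrI.
  rewrite -[u]hsubmxK -[v]hsubmxK uvr; congr row_mx.
  by apply/matrixP => i j; rewrite !ord1.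
- move=> y; rewrite inE => /orP[/eqP ->|/TX [u <-]].
    by exists (row_mx 1%:M 0); rewrite row_mxKr row_mxKl T0 addr0 mxE rmorph1 scale1r.
  by exists (row_mx 0 u); rewrite row_mxKr row_mxKl mxE rmorph0 scale0r add0r.
- move=> P Psub PX u; apply: Psub.2; first by apply: PX; rewrite mem_head.
  by apply: Tmin => // y yX; apply: PX; rewrite inE yX orbT.
Qed.

End Coordinates.

Section RationalSpan.
Variables (R : realType) (V : lmodType R).
Implicit Types (S P : set V).

Lemma sub_rat_span S : S `<=` rat_span S.
Proof.
move=> x Sx; exists 1%N, (fun=> 1), (fun=> x); split => //.
by rewrite big_ord1 rmorph1 scale1r.
Qed.

Lemma rat_span_min S P : rat_subspace P -> S `<=` P -> rat_span S `<=` P.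
Proof.
move=> Psub SP _ [k [q [x [Sx ->]]]]; apply: rat_subspace_sum => // i _.
by apply: rat_subspaceZ => //; apply: SP.
Qed.

Lemma rat_span_subspace S : rat_subspace (rat_span S).
Proof.
split=> [|a _ _ [k [q [x [Sx ->]]]] [l [r [y [Sy ->]]]]].
  by exists 0%N, (fun=> 0), (fun=> 0); split => [[]//|]; rewrite big_ord0.
exists (k + l)%N, (fun i => match fintype.split i with inl j => a * q j | inr j => r j end),
  (fun i => match fintype.split i with inl j => x j | inr j => y j end); split.
  by move=> i; case: (fintype.split i).
rewrite big_split_ord/= scaler_sumr; congr (_ + _); apply: eq_bigr => i _.
  by rewrite (unsplitK (inl i : 'I_k + 'I_l)%type) rmorphM scalerA.
by rewrite (unsplitK (inr i : 'I_k + 'I_l)%type).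
Qed.

Lemma rat_span_sub S S' : S `<=` S' -> rat_span S `<=` rat_span S'.
Proof.
move=> SS'; apply: rat_span_min; first exact: rat_span_subspace.
by apply: (subset_trans SS'); apply: sub_rat_span.
Qed.

End RationalSpan.

(** * The Baker-Campbell-Hausdorff series to second order *)

Section BakerCampbellHausdorff.
Variables (R : realType) (V : lmodType R) (br : V -> V -> V).
Hypothesis brP : is_lie_bracket br.

Let brL := let: And4 h _ _ _ := brP in h.
Let brR := let: And4 _ h _ _ := brP in h.

Lemma brDl x y z : br (x + y) z = br x z + br y z.
Proof. exact: bilDl. Qed.

Lemma brDr z x y : br z (x + y) = br z x + br z y.
Proof. exact: bilDr. Qed.

Lemma br0l z : br 0 z = 0.
Proof. exact: bil0l. Qed.

Lemma br0r z : br z 0 = 0.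
Proof. exact: bil0r. Qed.

Lemma brZl a x z : br (a *: x) z = a *: br x z.
Proof. exact: bilZl. Qed.

Lemma brZr a z x : br z (a *: x) = a *: br z x.
Proof. exact: bilZr. Qed.

Lemma brNl x z : br (- x) z = - br x z.
Proof. by rewrite -scaleN1r brZl scaleN1r. Qed.

Lemma brNr z x : br z (- x) = - br z x.
Proof. by rewrite -scaleN1r brZr scaleN1r. Qed.

Lemma brxx x : br x x = 0.
Proof. by case: brP. Qed.

Lemma brC x y : br x y = - br y x.
Proof.
have := brxx (x + y); rewrite brDl !brDr !brxx add0r addr0.
by move/eqP; rewrite addr_eq0 => /eqP.
Qed.

Lemma br_jacobi x y z : br (br x y) z = br x (br y z) - br y (br x z).
Proof.
case: brP => _ _ _ /(_ x y z).
by rewrite [br z x]brC brNr [br z _]brC => /subr0_eq.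
Qed.

Lemma rat_subspace_brl (P : set V) y :
  rat_subspace P -> rat_subspace [set x | P (br x y)].
Proof.
move=> Psub; split=> /= [|q x z Px Pz]; first by rewrite br0l; apply: rat_subspace0.
by rewrite brDl brZl; apply: Psub.2.
Qed.

Lemma rat_subspace_brr (P : set V) y :
  rat_subspace P -> rat_subspace [set x | P (br y x)].
Proof.
move=> Psub; split=> /= [|q x z Px Pz]; first by rewrite br0r; apply: rat_subspace0.
by rewrite brDr brZr; apply: Psub.2.
Qed.

Lemma iter_bracket_cons x s :
  s != [::] -> iter_bracket br (x :: s) = br x (iter_bracket br s).
Proof. by case: s. Qed.

Lemma iter_bracket_nseq n x : (1 < n)%N -> iter_bracket br (nseq n x) = 0.
Proof. by case: n => [|[|n]] // _; elim: n => [|n /= ->]; rewrite /= ?brxx ?br0r. Qed.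

Variable M : nat -> set V.
Hypothesis Msub : forall i, rat_subspace (M i).
Hypothesis MS : forall i, M i.+1 `<=` M i.
Hypothesis Mbr : forall i x y, M 0 x -> M i y -> M i.+1 (br x y).

Lemma filtration_le i j : (i <= j)%N -> M j `<=` M i.
Proof.
by move=> /subnKC <-; elim: (j - i)%N => [|k IH]; rewrite ?addn0// addnS => x /MS /IH.
Qed.

Section Words.
Variables (x y : V) (j : nat).
Hypotheses (Mx : M 0 x) (My : M 0 y) (Mxy : M j (br x y)).

(** The innermost bracket of a word in [x] and [y] is 0 or [br x y] up to sign, which lies in layer
    [j]; each further letter descends one layer. *)
Lemma iter_bracket_word s n :
  (forall z, z \in s -> z = x \/ z = y) -> size s = n.+2 ->
  M (j + n) (iter_bracket br s).
Proof.
elim: s n => // a [//|b s] IH n sxy [sz].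
have sab : a = x \/ a = y by apply: sxy; rewrite mem_head.
have Ma : M 0 a by case: sab => ->.
have sxy' z : z \in b :: s -> z = x \/ z = y by move=> h; apply: sxy; rewrite in_cons h orbT.
case: n sz => [|n] sz.
  have : b = x \/ b = y by apply: sxy'; rewrite mem_head.
  move/size0nil: sz sab => -> /= [] -> [] ->; rewrite addn0 ?brxx //.
  - exact: rat_subspace0.
  - by rewrite brC; apply: rat_subspaceN.
  - exact: rat_subspace0.
by rewrite addnS iter_bracket_cons//; apply: Mbr => //; apply: IH; rewrite //= sz.
Qed.


Variable c : nat.
Hypothesis br_nilp : lie_nilpotent br c.

(** Together with [bch_coef] and [bch_level] this names the pieces of Dynkin's sum exactly as they
    occur in [bch], so that [bch_mod] recovers them by conversion. *)
Definition bch_word k (f : {ffun 'I_k -> 'I_c.+1 * 'I_c.+1}) : seq V :=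
  flatten [seq nseq (f i).1 x ++ nseq (f i).2 y | i <- enum 'I_k].

Definition bch_size k (f : {ffun 'I_k -> 'I_c.+1 * 'I_c.+1}) : nat :=
  \sum_i ((f i).1 + (f i).2)%N.

Lemma size_bch_word k (f : {ffun 'I_k -> 'I_c.+1 * 'I_c.+1}) :
  size (bch_word f) = bch_size f.
Proof.
rewrite size_flatten /shape -map_comp sumnE big_map big_enum /=.
by apply: eq_bigr => i _; rewrite size_cat !size_nseq.
Qed.

Lemma in_bch_word k (f : {ffun 'I_k -> 'I_c.+1 * 'I_c.+1}) z :
  z \in bch_word f -> z = x \/ z = y.
Proof.
case/flattenP => _ /mapP[i _ ->].
by rewrite mem_cat => /orP[] /nseqP[-> _]; [left|right].
Qed.

Lemma iter_bracket_bch_word k (f : {ffun 'I_k -> 'I_c.+1 * 'I_c.+1}) :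
  (2 < bch_size f)%N -> M j.+1 (iter_bracket br (bch_word f)).
Proof.
rewrite -size_bch_word; case E: (size _) => [|[|[|n]]] // _.
apply: (@filtration_le _ (j + n.+1)); first by rewrite addnS ltnS leq_addr.
by apply: iter_bracket_word E => z; apply: in_bch_word.
Qed.

Definition bch_coef k (f : {ffun 'I_k -> 'I_c.+1 * 'I_c.+1}) : R :=
  ((\sum_i ((f i).1 + (f i).2))%N%:R *
       (\prod_i ((f i).1`! * (f i).2`!))%N%:R)^-1.

Definition bch_level k : V :=
  \sum_(f : {ffun 'I_k -> 'I_c.+1 * 'I_c.+1} |
          [forall i, 0 < (f i).1 + (f i).2]%N)
     bch_coef f *: iter_bracket br (bch_word f).

Lemma bch_coefE k (f : {ffun 'I_k -> 'I_c.+1 * 'I_c.+1}) :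
  exists q : rat, bch_coef f = ratr q.
Proof.
by rewrite /bch_coef -natrM -(ratr_nat R) -fmorphV; eexists.
Qed.

Lemma bch_levelP k (S : pred {ffun 'I_k -> 'I_c.+1 * 'I_c.+1}) :
  (forall f, S f -> (2 < bch_size f)%N) ->
  M j.+1 (\sum_(f | S f) bch_coef f *: iter_bracket br (bch_word f)).
Proof.
move=> S2; apply: rat_subspace_sum => // f /S2 f2.
by have [q ->] := bch_coefE f; apply: rat_subspaceZ => //; apply: iter_bracket_bch_word.
Qed.

Lemma bch_level_ge3 k : (2 < k)%N -> M j.+1 (bch_level k).
Proof.
move=> k2; apply: bch_levelP => f /forallP f0; apply: leq_trans k2 _.
rewrite -[X in (X <= _)%N]card_ord -sum1_card; apply: leq_sum => i _; exact: f0.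
Qed.

(* The words of total degree 2 in the second level all carry the same
   coefficient, and swapping the two factors negates the bracket. *)
Lemma bch_level2 : M j.+1 (bch_level 2).
Proof.
rewrite /bch_level (bigID (fun f => bch_size f == 2)%N) /=.
apply: rat_subspaceD => //; last first.
  apply: bch_levelP => f /andP[/forallP f0]; rewrite ltn_neqAle eq_sym => -> /=.
  rewrite -[X in (X <= _)%N](card_ord 2) -sum1_card; apply: leq_sum => i _; exact: f0.
set S := \sum_(_ | _) _.
suff -> : S = 0 by apply: rat_subspace0.
have : S = - S; last first.
  by move/eqP; rewrite -subr_eq0 opprK -mulr2n -scaler_nat scaler_eq0 pnatr_eq0 => /eqP.
pose sw (f : {ffun 'I_2 -> 'I_c.+1 * 'I_c.+1}) := [ffun i => f (rev_ord i)].
have swK : involutive sw by move=> f; apply/ffunP => i; rewrite !ffunE rev_ordK.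
have swsz f : bch_size (sw f) = bch_size f.
  rewrite /bch_size (reindex_inj rev_ord_inj) /=.
  by apply: eq_bigr => i _; rewrite ffunE rev_ordK.
rewrite {1}/S (reindex_inj (inv_inj swK)) /= /S -sumrN; apply: eq_big => f.
  rewrite swsz; congr (_ && _); apply/forallP/forallP => h i.
    by have := h (rev_ord i); rewrite ffunE rev_ordK.
  by rewrite ffunE.
move=> /andP[/forallP sf0 /eqP fsz].
have f0 i : (0 < (f i).1 + (f i).2)%N by have := sf0 (rev_ord i); rewrite ffunE rev_ordK.
have -> : bch_coef (sw f) = bch_coef f.
  rewrite /bch_coef; congr ((_ * _)^-1).
    rewrite [in LHS](reindex_inj rev_ord_inj) /=; congr (_%:R).
    by apply: eq_bigr => i _; rewrite ffunE rev_ordK.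
  rewrite [in LHS](reindex_inj rev_ord_inj) /=; congr (_%:R).
  by apply: eq_bigr => i _; rewrite ffunE rev_ordK.
rewrite -scalerN; congr (_ *: _).
(* Two nonempty factors of total degree 2 consist of a single letter each. *)
have f1 i : exists2 a, nseq (f i).1 x ++ nseq (f i).2 y = [:: a] & True.
  have : ((f i).1 + (f i).2 = 1)%N.
    rewrite swsz /bch_size !big_ord_recl big_ord0 addn0 in fsz.
    have nat2 (a b : nat) : (a + b = 2 -> 0 < a -> 0 < b -> a = 1 /\ b = 1)%N.
      by case: a b => [|[|a]] [|[|b]] //; rewrite !addSn ?addnS.
    have [f00 f01] := nat2 _ _ fsz (f0 ord0) (f0 (lift ord0 ord0)).
    have [->|->] // : i = ord0 \/ i = lift ord0 ord0.
    by case: i => [[|[|]]//] h; [left|right]; apply: val_inj.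
  case: (nat_of_ord (f i).1) => [|[|r]].
  - by rewrite add0n => ->; exists y.
  - by rewrite add1n => -[->]; exists x.
  - by rewrite !addSn.
have [a aE _] := f1 ord0; have [b bE _] := f1 (lift ord0 ord0).
have e2 : enum 'I_2 = [:: ord0; lift ord0 ord0].
  by rewrite !enum_ordSl enum_ord0.
rewrite /bch_word e2 /= !ffunE.
have -> : rev_ord (ord0 : 'I_2) = lift ord0 ord0 by apply: val_inj.
have -> : rev_ord (lift ord0 ord0 : 'I_2) = ord0 by apply: val_inj.
by rewrite aE bE /= brC.
Qed.

(** The exponents (1,0), (0,1) and (1,1) give [x], [y] and half of [br x y]. Pure powers of degree
    above 1 vanish, and all other words have at least three letters. The hypothesis [0 < c] lets the
    exponent 1 occur. *)
Lemma bch_level1 : (0 < c)%N -> M j.+1 (bch_level 1 - (x + y + ratr 2^-1 *: br x y)).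
Proof.
move=> c0.
pose F (p : 'I_c.+1 * 'I_c.+1) := ((p.1 + p.2)%N%:R * (p.1`! * p.2`!)%N%:R)^-1 *:
   iter_bracket br (nseq p.1 x ++ nseq p.2 y) : V.
have -> : bch_level 1 = \sum_(p : 'I_c.+1 * 'I_c.+1 | (0 < p.1 + p.2)%N) F p.
  pose h (p : 'I_c.+1 * 'I_c.+1) : {ffun 'I_1 -> 'I_c.+1 * 'I_c.+1} := [ffun=> p].
  rewrite /bch_level (reindex h) /=; last first.
    exists (fun f : {ffun 'I_1 -> 'I_c.+1 * 'I_c.+1} => f ord0) => [p _|f _].
      by rewrite ffunE.
    by apply/ffunP => i; rewrite ffunE; congr (f _); apply/val_inj; case: i => [[]].
  apply: eq_big => [p|p _].
    by apply/forallP/idP => [/(_ ord0)|h' i]; rewrite ffunE.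
  rewrite /bch_coef !big_ord1 !ffunE /F; congr (_ *: iter_bracket _ _).
  have e1 : enum 'I_1 = [:: ord0].
    by rewrite !enum_ordSl enum_ord0.
  by rewrite /bch_word e1 /= ffunE cats0.
have F2 (r s : 'I_c.+1) : (2 < r + s)%N -> M j.+1 (F (r, s)).
  move=> rs; have := @iter_bracket_bch_word 1 [ffun=> (r, s)].
  have := @bch_coefE 1 [ffun=> (r, s)].
  rewrite /bch_coef /bch_word /bch_size /F enum_ordSl enum_ord0 /= !big_ord1 !ffunE cats0.
  by move=> [q ->] /(_ rs) h; apply: rat_subspaceZ.
have Fx0 (r : 'I_c.+1) : (1 < r)%N -> F (r, ord0) = 0.
  by move=> r1; rewrite /F /= cats0 iter_bracket_nseq // scaler0.
have F0y (s : 'I_c.+1) : (1 < s)%N -> F (ord0, s) = 0.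
  by move=> s1; rewrite /F /= iter_bracket_nseq // scaler0.
(* The pair (0,0) may be added, as the bracket of the empty word is 0. *)
have -> : \sum_(p : 'I_c.+1 * 'I_c.+1 | (0 < p.1 + p.2)%N) F p = \sum_r \sum_s F (r, s).
  rewrite pair_big [RHS](bigID (fun p : 'I_c.+1 * 'I_c.+1 => 0 < p.1 + p.2)%N) /=.
  rewrite [X in _ = _ + X]big1 ?addr0 => [|[r s] /=]; first by apply: eq_bigr => -[].
  rewrite -eqn0Ngt addn_eq0 => /andP[/eqP r0 /eqP s0].
  by rewrite /F /= r0 s0 scaler0.
case: (c) c0 @F F2 Fx0 F0y => // d _ F F2 Fx0 F0y.
pose o1 : 'I_d.+2 := lift ord0 ord0.
have -> : \sum_r \sum_s F (r, s) = x + y + ratr 2^-1 *: br x y +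
   (\sum_(s < d) F (o1, lift ord0 (lift ord0 s)) +
    \sum_(r < d) \sum_(s < d.+1) F (lift ord0 (lift ord0 r), lift ord0 s)).
  rewrite !big_ord_recl -/o1.
  have -> : F (ord0, ord0) = 0 by rewrite /F /= scaler0.
  have -> : F (ord0, o1) = y by rewrite /F /= !mul1r invr1 scale1r.
  have -> : F (o1, ord0) = x by rewrite /F /= !mul1r invr1 scale1r.
  have -> : F (o1, o1) = ratr 2^-1 *: br x y.
    by rewrite /F /= mulr1 -(ratr_nat R) -fmorphV.
  rewrite big1 => [|i _]; last exact: F0y.
  have -> : \sum_(r < d) \sum_s F (lift ord0 (lift ord0 r), s) =
      \sum_(r < d) \sum_(s < d.+1) F (lift ord0 (lift ord0 r), lift ord0 s).
    by apply: eq_bigr => r _; rewrite big_ord_recl Fx0 // add0r.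
  by rewrite add0r addr0 !addrA [y + x]addrC.
rewrite addrAC subrr add0r; apply: rat_subspaceD => //.
  by apply: rat_subspace_sum => // s _; apply: F2; rewrite /= /bump !leq0n !add1n ?addnS ?addSn.
apply: rat_subspace_sum => // r _; apply: rat_subspace_sum => // s _.
by apply: F2; rewrite /= /bump !leq0n !add1n ?addnS ?addSn.
Qed.

(** Only level 1 contributes in degree at most 2, since the quadratic words of level 2 cancel;
    everything of higher degree lies in layer [j.+1]. *)
Lemma bch_mod : M j.+1 (bch br c x y - (x + y + ratr 2^-1 *: br x y)).
Proof.
have [c0|c0] := posnP c.
  (* In class 0 a bracket of one letter already vanishes, so the space is trivial. *)
  have V0 (v : V) : v = 0 by rewrite -[LHS]/(iter_bracket br [:: v]) br_nilp ?c0.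
  by rewrite (V0 (_ - _)); apply: rat_subspace0.
have -> : bch br c x y =
    \sum_(1 <= k < c.+1) ((-1) ^+ k.-1 / k%:R) *: bch_level k by [].
rewrite big_ltn ?ltnS // expr0 divr1 scale1r addrAC; apply: rat_subspaceD => //.
  exact: bch_level1.
rewrite big_seq_cond; apply: rat_subspace_sum => // k; rewrite mem_index_iota andbT.
move=> /andP[k1 _].
have -> : (-1) ^+ k.-1 / k%:R = ratr ((-1) ^+ k.-1 / k%:R) :> R.
  by rewrite fmorph_div rmorphXn rmorphN1 rmorph_nat.
apply: rat_subspaceZ => //.
case: k k1 => [|[|[|k]]] // _; first exact: bch_level2.
exact: bch_level_ge3.
Qed.

End Words.
End BakerCampbellHausdorff.

(** * Rational multiples of logarithms *)

Section WordSpan.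
Variables (R : realType) (V : lmodType R) (br : V -> V -> V).
Hypothesis brP : is_lie_bracket br.
Implicit Types (X : set V).

(** Words have more than [i] letters, so [word_span X 0] is the rational Lie algebra generated by
    [X], and the sets [word_span X i] form its lower central series, numbered from 0. *)
Definition word_span X (i : nat) : set V :=
  rat_span [set v | exists s : seq V,
    [/\ forall z, z \in s -> X z, (i < size s)%N & v = iter_bracket br s]].

Lemma word_span_subspace X i : rat_subspace (word_span X i).
Proof. exact: rat_span_subspace. Qed.

Lemma iter_bracket_word_span X s i :
  (forall z, z \in s -> X z) -> (i < size s)%N ->
  word_span X i (iter_bracket br s).
Proof. by move=> sX si; apply: sub_rat_span; exists s. Qed.

Lemma word_spanS X i : word_span X i.+1 `<=` word_span X i.
Proof. by apply: rat_span_sub => v [s [sX /ltnW si ->]]; exists s. Qed.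

Lemma sub_word_span X : X `<=` word_span X 0.
Proof.
by move=> x Xx; apply: (@iter_bracket_word_span X [:: x]) => // z; rewrite inE => /eqP ->.
Qed.

Lemma word_span_br_letter X i x w : X x -> word_span X i w -> word_span X i.+1 (br x w).
Proof.
move=> Xx; move: w; apply: (rat_span_min (P := [set w | word_span X i.+1 (br x w)])).
  by apply: rat_subspace_brr => //; apply: word_span_subspace.
move=> _ [t [tX ti ->]] /=; rewrite -iter_bracket_cons; last by case: t ti {tX}.
by apply: iter_bracket_word_span => // z; rewrite inE => /orP[/eqP->//|]; apply: tX.
Qed.

(** Induction on the word [v]: by Jacobi, bracketing with [br x u] becomes bracketing with [x] and
    [u] in both orders, which descends two layers where one suffices. *)
Lemma word_span_br X i v w :
  word_span X 0 v -> word_span X i w -> word_span X i.+1 (br v w).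
Proof.
move=> + Xw; move: v; apply: (rat_span_min (P := [set v | word_span X i.+1 (br v w)])).
  by apply: rat_subspace_brl => //; apply: word_span_subspace.
move=> _ [s [sX s0 ->]] /=; elim: s sX s0 i w Xw => // x [|y s] IH sX _ i w Xw.
  by apply: word_span_br_letter => //; apply: sX; rewrite mem_head.
have Xx : X x by apply: sX; rewrite mem_head.
have {}IH j z : word_span X j z -> word_span X j.+1 (br (iter_bracket br (y :: s)) z).
  by apply: IH => // a sa; apply: sX; rewrite inE sa orbT.
rewrite iter_bracket_cons// br_jacobi//; apply: rat_subspaceB; first exact: word_span_subspace.
  by apply/word_spanS/word_span_br_letter => //; apply: IH.
by apply/word_spanS/IH/word_span_br_letter.
Qed.

Lemma word_span_le X i j : (i <= j)%N -> word_span X j `<=` word_span X i.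
Proof. by apply: filtration_le => k; apply: word_spanS. Qed.

Section Nilpotent.
Variable c : nat.
Hypothesis br_nilp : lie_nilpotent br c.

Lemma iter_bracket_long s : (c < size s)%N -> iter_bracket br s = 0.
Proof.
elim: s => // x s IH; rewrite ltnS leq_eqVlt => /orP[/eqP cs|cs].
  by apply: br_nilp; rewrite /= cs.
by rewrite iter_bracket_cons ?IH ?br0r //; case: s cs {IH}.
Qed.

Lemma word_span_nilp X i v : (c <= i)%N -> word_span X i v -> v = 0.
Proof.
move=> ci; apply: (rat_span_min (P := [set 0])) v.
  by split=> //= q x y -> ->; rewrite scaler0 addr0.
by move=> _ [s [_ si ->]]; apply: iter_bracket_long; apply: leq_ltn_trans si.
Qed.

Lemma bch_word_span X x y j :
  word_span X 0 x -> word_span X 0 y -> word_span X j (br x y) ->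
  word_span X j.+1 (bch br c x y - (x + y + ratr 2^-1 *: br x y)).
Proof.
move=> Xx Xy Xxy; apply: bch_mod => //.
- exact: word_span_subspace.
- exact: word_spanS.
- by move=> *; apply: word_span_br.
Qed.

(** A zero bracket lies in every layer, in particular in layer [c], so the error of [x + y] lies in
    a layer beyond the class and vanishes. *)
Lemma bch_commuting x y : br x y = 0 -> bch br c x y = x + y.
Proof.
move=> xy; pose X := [set x; y].
have := @bch_word_span X x y c.
rewrite xy scaler0 addr0 => h; apply/subr0_eq; apply: (@word_span_nilp X c.+1) => //.
apply: h; last exact: (rat_subspace0 (word_span_subspace X c)).
  by apply: sub_word_span; left.
by apply: sub_word_span; right.
Qed.

Lemma bch0x x : bch br c 0 x = x.
Proof. by rewrite bch_commuting ?add0r ?br0l. Qed.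

Lemma bchNx x : bch br c (- x) x = 0.
Proof. by rewrite bch_commuting ?addNr // brNl // brxx // oppr0. Qed.

Section GroupLog.
Variables (G : groupType) (l : G -> V).
Hypothesis lM : forall g h, l (g * h)%g = bch br c (l g) (l h).
Hypothesis lV : forall g, l g^-1%g = - l g.

Local Notation M := (word_span (range l)).

Let Msub i : rat_subspace (M i). Proof. exact: word_span_subspace. Qed.
Hint Resolve Msub : core.

Lemma log_word_span g : M 0 (l g).
Proof. by apply: sub_word_span; exists g. Qed.
Hint Resolve log_word_span : core.

Lemma log_mul_mod g h j : M j (br (l g) (l h)) ->
  M j.+1 (l (g * h)%g - (l g + l h + ratr 2^-1 *: br (l g) (l h))).
Proof. by move=> ?; rewrite lM; apply: bch_word_span. Qed.

Lemma log_mul_add_mod g h j : M j (br (l g) (l h)) ->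
  M j (l (g * h)%g - (l g + l h)).
Proof.
move=> gh; have /word_spanS := log_mul_mod gh.
move: (l g + l h) => z.
have -> : l (g * h)%g - z = ratr 2^-1 *: br (l g) (l h) +
    (l (g * h)%g - (z + ratr 2^-1 *: br (l g) (l h))).
  by rewrite addrCA opprD; congr (_ + _); rewrite addrCA subrr addr0.
by apply: rat_subspaceD => //; apply: rat_subspaceZ.
Qed.

Lemma log1 : l 1%g = 0.
Proof. by rewrite -(mulVg 1%g) lM lV bchNx. Qed.

Lemma logX g n : l (g ^+ n)%g = l g *+ n.
Proof.
elim: n => [|n IH]; first by rewrite expg0 log1.
rewrite expgS lM IH bch_commuting ?mulrS // -scaler_nat brZr //.
by rewrite brxx // scaler0.
Qed.

(** With [[~ a, b]] written as [(b * a)^-1 * (a * b)], the logarithms of [a * b] and [b * a] differ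
    by [br (l a) (l b)] modulo layer [i.+2]: the symmetric terms cancel and the two halves add
    up. *)
Lemma log_commg_mod a b i : M i (l b) -> M i.+2 (l [~ a, b]%g - br (l a) (l b)).
Proof.
move=> Mb; have Mab : M i.+1 (br (l a) (l b)) by apply: word_span_br.
have Mba : M i.+1 (br (l b) (l a)) by rewrite brC //; apply: rat_subspaceN.
set d := l (a * b)%g - l (b * a)%g.
have d_br : M i.+2 (d - br (l a) (l b)).
  have := rat_subspaceB (Msub i.+2) (log_mul_mod Mab) (log_mul_mod Mba).
  rewrite [br (l b) _]brC // scalerN.
  have -> : l a + l b + ratr 2^-1 *: br (l a) (l b) =
      l b + l a - ratr 2^-1 *: br (l a) (l b) + br (l a) (l b).
    have half2 : ratr 2^-1 + ratr 2^-1 = 1 :> R.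
      by rewrite -rmorphD -(rmorph1 (@ratr R)); congr ratr; apply/eqP.
    rewrite -[X in _ = _ + X]scale1r -half2 scalerDl addrA subrK.
    by rewrite [l b + _]addrC.
  move: (l b + l a - _) => T; rewrite [T + _]addrC opprD opprB !addrA subrK.
  by rewrite addrAC.
have Md : M i.+1 d.
  by have := rat_subspaceD (Msub i.+1) (word_spanS d_br) Mab; rewrite subrK.
have -> : [~ a, b]%g = ((b * a)^-1 * (a * b))%g.
  by rewrite commgEl conjgE invgM !mulgA.
(* As [l (a * b)] is [d + l (b * a)], only the bracket with [d] survives, and it lies in layer
   [i.+2]. *)
have /log_mul_add_mod : M i.+2 (br (l (b * a)^-1%g) (l (a * b)%g)).
  rewrite lV brNl //; apply: rat_subspaceN => //.
  have -> : l (a * b)%g = d + l (b * a)%g by rewrite subrK.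
  by rewrite (brDr brP) brxx // addr0; apply: word_span_br.
rewrite lV [- _ + _]addrC -/d => h.
by have := rat_subspaceD (Msub _) h d_br; rewrite addrA subrK.
Qed.

(** Iterated commutators in [G] realise iterated brackets of logarithms up to deeper terms. *)
Lemma iter_bracket_log s : s != [::] -> (forall z, z \in s -> range l z) ->
  exists g, M (size s) (l g - iter_bracket br s).
Proof.
elim: s => // x [|y s] IH _ sG.
  have [g _ <-] := sG x (mem_head _ _).
  by exists g; rewrite subrr; apply: rat_subspace0.
have [a _ ax] := sG x (mem_head _ _).
have [z zs|b Mb] := IH isT; first by apply: sG; rewrite inE zs orbT.
set u := iter_bracket br (y :: s) in Mb *.
have Mu : M (size s) u.
  by apply: iter_bracket_word_span => // z zs; apply: sG; rewrite inE zs orbT.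
have Mb' : M (size s) (l b).
  by have := rat_subspaceD (Msub _) (word_spanS Mb) Mu; rewrite subrK.
exists [~ a, b]%g; rewrite iter_bracket_cons // -/u -ax.
have -> : l [~ a, b]%g - br (l a) u =
    (l [~ a, b]%g - br (l a) (l b)) + br (l a) (l b - u).
  by rewrite (brDr brP) (brNr brP) addrA subrK.
by apply: rat_subspaceD => //; [apply: log_commg_mod | apply: word_span_br].
Qed.

(** Leading terms of logarithms in layer [i]; allowing a positive multiple makes the set closed
    under division. *)
Definition graded_log i : set V :=
  [set v | M i v /\ exists2 k : nat, (0 < k)%N & exists g, M i.+1 (l g - v *+ k)].

Lemma graded_log_mem i v g k : M i v -> M i.+1 (l g - v *+ k) -> M i (l g).
Proof.
move=> Mv /word_spanS Mg.
by have := rat_subspaceD (Msub _) Mg (rat_subspaceMn (Msub i) k Mv); rewrite subrK.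
Qed.

Lemma graded_log_mul_mod i g h x y : M i x -> M i y ->
  M i.+1 (l g - x) -> M i.+1 (l h - y) -> M i.+1 (l (g * h)%g - (x + y)).
Proof.
move=> Mx My Mg Mh.
have Mlh : M i (l h).
  by have := rat_subspaceD (Msub _) (word_spanS Mh) My; rewrite subrK.
have /log_mul_add_mod h' : M i.+1 (br (l g) (l h)) by apply: word_span_br.
have := rat_subspaceD (Msub _) h' (rat_subspaceD (Msub _) Mg Mh).
by rewrite [X in _ _ (_ + X)]addrACA -opprD addrA subrK.
Qed.

(** Modulo the next layer the logarithm turns powers, inverses and products into multiples,
    negatives and sums; division is absorbed by the multiple [k]. *)
Lemma graded_log_subspace i : rat_subspace (graded_log i).
Proof.
have G0 : graded_log i 0.
  split; first exact: rat_subspace0.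
  by exists 1%N => //; exists 1%g; rewrite log1 subrr; apply: rat_subspace0.
have GMn v n : graded_log i v -> graded_log i (v *+ n).
  move=> [Mv [k k0 [g Mg]]]; split; first exact: rat_subspaceMn.
  exists k => //; exists (g ^+ n)%g; rewrite logX mulrnAC -mulrnBl.
  exact: rat_subspaceMn.
have GN v : graded_log i v -> graded_log i (- v).
  move=> [Mv [k k0 [g Mg]]]; split; first exact: rat_subspaceN.
  exists k => //; exists (g^-1)%g; rewrite lV mulNrn opprK addrC -opprB.
  exact: rat_subspaceN.
have Gdiv v n : (0 < n)%N -> graded_log i v -> graded_log i (ratr n%:R^-1 *: v).
  move=> n0 [Mv [k k0 [g Mg]]]; split; first exact: rat_subspaceZ.
  exists (n * k)%N; rewrite ?muln_gt0 ?n0 //; exists g.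
  rewrite mulrnA -[_ *+ n]scaler_nat scalerA fmorphV rmorph_nat divff ?scale1r //.
  by rewrite pnatr_eq0 -lt0n.
have GD v w : graded_log i v -> graded_log i w -> graded_log i (v + w).
  move=> [Mv [k k0 [g Mg]]] [Mw [m m0 [h Mh]]]; split; first exact: rat_subspaceD.
  (* The crosswise exponents bring both elements to the common multiple [k * m]. *)
  exists (k * m)%N; rewrite ?muln_gt0 ?k0 //; exists (g ^+ m * h ^+ k)%g.
  rewrite mulrnDl; apply: graded_log_mul_mod; rewrite ?logX.
  - exact: rat_subspaceMn.
  - exact: rat_subspaceMn.
  - by rewrite mulrnA -mulrnBl; apply: rat_subspaceMn.
  - by rewrite mulnC mulrnA -mulrnBl; apply: rat_subspaceMn.
split=> // q v w Gv Gw; apply: GD => //.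
rewrite -[q]divq_num_den -[denq q]gez0_abs ?denq_ge0 // mulrC rmorphM -scalerA.
apply: Gdiv; first by rewrite absz_gt0 denq_neq0.
case: (numq q) => n; first by rewrite -pmulrn rmorph_nat scaler_nat; apply: GMn.
by rewrite NegzE mulrNz rmorphN -pmulrn rmorph_nat scaleNr scaler_nat; apply/GN/GMn.
Qed.

(** Words of exactly [i.+1] letters come from iterated commutators with multiple 1; longer ones
    vanish modulo the next layer, so the unit of the group serves. *)
Lemma word_span_graded_log i : M i `<=` graded_log i.
Proof.
apply: rat_span_min; first exact: graded_log_subspace.
move=> _ [s [sG si ->]]; split; first exact: iter_bracket_word_span.
exists 1%N => //; move: si; rewrite leq_eqVlt => /orP[/eqP si|si].
  have [|g] := iter_bracket_log _ sG; first by case: s si {sG}.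
  by rewrite -si; exists g.
exists 1%g; rewrite log1 sub0r; apply: rat_subspaceN => //.
exact: iter_bracket_word_span.
Qed.

(* The error [k v - l g] is pushed one layer deeper at each step: its leading
   term is matched by some [u] in [G], after passing to powers. *)
Lemma word_span_log v : M 0 v -> exists2 k : nat, (0 < k)%N & exists g, l g = v *+ k.
Proof.
move=> Mv; suff [k k0 [g Mg]] :
    exists2 k : nat, (0 < k)%N & exists g, M c (v *+ k - l g).
  exists k => //; exists g; apply/esym/subr0_eq.
  exact: (word_span_nilp (leqnn c) Mg).
elim: c => [|i [k k0 [g Mg]]].
  by exists 1%N => //; exists 1%g; rewrite log1 subr0.
have [_ [m m0 [u Mu]]] := word_span_graded_log Mg.
exists (k * m)%N; first by rewrite muln_gt0 k0.
exists (g ^+ m * u)%g; rewrite mulrnA.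
have Mlu : M i (l u) by apply: graded_log_mem Mg Mu.
have /log_mul_add_mod h : M i.+1 (br (l (g ^+ m)%g) (l u)) by apply: word_span_br.
have := rat_subspaceN (Msub _) (rat_subspaceD (Msub _) h Mu).
rewrite logX mulrnBl; move: (l g *+ m) (v *+ k *+ m) => x y.
by rewrite (opprB y) (addrA (l u)) (addrC (l u)) addrA subrK opprB.
Qed.

(** Dividing by [k] in [word_span_log] gives the nontrivial inclusion. Hence the rational span of
    the logarithms is closed under brackets. *)
Lemma rat_span_logE : rat_span (range l) = M 0.
Proof.
rewrite eqEsubset; split; first exact: rat_span_min (sub_word_span (X := _)).
move=> v /word_span_log [k k0 [g gE]].
have -> : v = ratr k%:R^-1 *: l g.
  rewrite gE -scaler_nat scalerA fmorphV rmorph_nat mulVf ?scale1r //.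
  by rewrite pnatr_eq0 -lt0n.
apply: rat_subspaceZ; first exact: rat_span_subspace.
by apply: sub_rat_span; exists g.
Qed.

End GroupLog.
End Nilpotent.
End WordSpan.

(** * Weight derivations *)

Section Trace.

(** A full rank factorization [P = C S] of an idempotent satisfies [S C = 1], and swapping the
    factors preserves the trace. *)
Lemma mxtrace_idempotent (F : fieldType) n (P : 'M[F]_n) :
  P *m P = P -> \tr P = (\rank P)%:R.
Proof.
move=> PP.
have := mulmx_base P; move: (col_base_full P) (row_base_free P).
move: (col_base P) (row_base P) => C S Cfull Sfree CS.
have SC : S *m C = 1%:M.
  apply: (row_free_inj Sfree); apply: (row_full_inj Cfull).
  by rewrite /= mul1mx -mulmxA mulmxA CS PP.
by rewrite -[in LHS]CS mxtrace_mulC SC mxtrace1.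
Qed.

Lemma char_poly_split n (A : 'M[algC]_n) :
  {rs : seq algC | char_poly A = \prod_(z <- rs) ('X - z%:P)}.
Proof.
have [rs] := closed_field_poly_normal (char_poly A).
by rewrite (monicP (char_poly_monic A)) scale1r; exists rs.
Qed.

Lemma mxtrace_nilpotent n (D : 'M[algC]_n.+1) k : D ^+ k = 0 -> \tr D = 0.
Proof.
move=> Dk; have [rs rsE] := char_poly_split D.
have rs0 z : z \in rs -> z = 0.
  rewrite -root_prod_XsubC -rsE -eigenvalue_root_char => /eigenvalueP[v vD v0].
  have vDk m : v *m D ^+ m = z ^+ m *: v.
    elim: m => [|m IH]; first by rewrite mulmx1 scale1r.
    by rewrite exprSr mulmxA IH -scalemxAl vD scalerA -exprSr.
  have := vDk k; rewrite Dk mulmx0 => /esym/eqP.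
  by rewrite scaler_eq0 (negPf v0) orbF expf_eq0 => /andP[_ /eqP].
have szrs : size rs = n.+1.
  by apply: succn_inj; rewrite -(size_prod_XsubC rs id) -rsE size_char_poly.
have : char_poly D = 'X^(n.+1).
  rewrite rsE (eq_big_seq (fun=> 'X)) => [|z /rs0 ->]; last by rewrite subr0.
  by rewrite big_const_seq count_predT iter_mulr_1 szrs.
move=> /(congr1 (fun p : {poly algC} => p`_n)); rewrite (char_poly_trace _ (ltn0Sn n)).
by rewrite coefXn ltn_eqF // => /eqP; rewrite oppr_eq0 => /eqP.
Qed.

End Trace.

(** * Generalized eigenspaces and the derivation attached to additive weights *)

Section WeightDerivation.
Variables (n : nat) (B : 'rV[algC]_n.+1 -> 'rV[algC]_n.+1 -> 'rV[algC]_n.+1).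
Hypothesis Bl : forall a x y z, B (a *: x + y) z = a *: B x z + B y z.
Hypothesis Br : forall a x y z, B z (a *: x + y) = a *: B z x + B z y.

Variable A : 'M[algC]_n.+1.
Hypothesis BA : forall u v, B (u *m A) (v *m A) = B u v *m A.

(** Induction on [k + m] by the identity [step], which trades one factor [A - ab] on [B u v] for a
    factor [A - a] on [u] or [A - b] on [v]. *)
Lemma bil_generalized_eigen a b k m u v :
  u *m (A - a%:M) ^+ k = 0 -> v *m (A - b%:M) ^+ m = 0 ->
  B u v *m (A - (a * b)%:M) ^+ (k + m) = 0.
Proof.
have [s] := ubnP (k + m); elim: s k m u v => // s IH k m u v; rewrite ltnS => ks.
case: k ks => [_|k ks]; first by rewrite mulmx1 => -> _; rewrite (bil0l Bl) mul0mx.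
case: m ks => [_ _|m ks]; first by rewrite mulmx1 => ->; rewrite (bil0r Br) mul0mx.
move=> uk vm.
have step : B u v *m (A - (a * b)%:M) =
    B (u *m (A - a%:M)) (v *m A) + a *: B u (v *m (A - b%:M)).
  rewrite !mulmxBr !mul_mx_scalar -(scaleN1r (a *: u)) -(scaleN1r (b *: v)).
  rewrite (bilDl Bl) BA (bilDr Br) !(bilZl Bl) !(bilZr Br) scalerDr addrA.
  by rewrite scaleN1r subrK scaleN1r scalerN scalerA.
rewrite addSn exprS mulmxA step mulmxDl -scalemxAl.
have -> : B (u *m (A - a%:M)) (v *m A) *m (A - (a * b)%:M) ^+ (k + m.+1) = 0.
  apply: IH => //; first by rewrite -[RHS]uk exprS mulmxA.
  have comm : GRing.comm A (A - b%:M) by apply: commrB => //; apply: comm_mx_scalar.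
  have commX : A *m (A - b%:M) ^+ m.+1 = (A - b%:M) ^+ m.+1 *m A := commrX m.+1 comm.
  by rewrite -mulmxA commX mulmxA vm mul0mx.
rewrite addnS -addSn IH ?scaler0 ?addr0 //; first by rewrite addSnnS.
by rewrite -[RHS]vm exprS mulmxA.
Qed.

Variables (r : nat) (a : 'I_r -> algC).
Hypothesis a_inj : injective a.
Hypothesis aE : forall z, eigenvalue A z = [exists i, a i == z].

(** The exponent is the dimension, which bounds every multiplicity, so the kernel of this polynomial
    at [A] is the whole generalized eigenspace. *)
Definition eig_poly i : {poly algC} := ('X - (a i)%:P) ^+ n.+1.

Lemma horner_XsubC_exp z k : horner_mx A (('X - z%:P) ^+ k) = (A - z%:M) ^+ k.
Proof. by rewrite rmorphXn rmorphB /= horner_mx_X horner_mx_C. Qed.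

Lemma coprimep_eig_poly i j : j != i -> coprimep (eig_poly i) (eig_poly j).
Proof.
move=> ji; apply/coprimep_expl/coprimep_expr/coprimep_XsubC2.
by rewrite subr_eq0 (inj_eq a_inj).
Qed.

(** The roots of the characteristic polynomial are among the [a i], with multiplicity at most
    [n.+1]; so it divides the product, and Cayley-Hamilton applies. *)
Lemma eig_poly_annihilates : horner_mx A (\prod_i eig_poly i) = 0.
Proof.
apply/eqP; rewrite -dvd_mxminpoly; apply: dvdp_trans (mxminpoly_dvd_char A) _.
have [rs rsE] := char_poly_split A; rewrite rsE.
have rs_a z : z \in rs -> exists i, a i = z.
  rewrite -root_prod_XsubC -rsE -eigenvalue_root_char aE => /existsP[i /eqP <-].
  by exists i.
have szrs : size rs = n.+1.
  by apply: succn_inj; rewrite -(size_prod_XsubC rs id) -rsE size_char_poly.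
have -> : \prod_(z <- rs) ('X - z%:P) = \prod_i ('X - (a i)%:P) ^+ (count_mem (a i) rs).
  under [RHS]eq_bigr => i _ do rewrite -sum1_count big_mkcond /= -prodrXr.
  rewrite exchange_big /=; apply: eq_big_seq => z /rs_a[i <-].
  rewrite (bigD1 i) //= eqxx expr1 big1 ?mulr1 // => j ji.
  by rewrite (inj_eq a_inj) eq_sym (negPf ji) expr0.
elim/big_rec2: _ => // i p q _ qp; apply: dvdp_mul => //.
by apply: dvdp_exp2l; rewrite -szrs count_size.
Qed.

Local Notation U i := (kermxpoly A (eig_poly i)).

Lemma eig_spaces_full : (1%:M <= \sum_i U i)%MS.
Proof.
rewrite -(kermxpoly_prod A (P := predT)) => [|i j _ _]; last exact: coprimep_eig_poly.
by apply/sub_kermxP; rewrite mul1mx eig_poly_annihilates.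
Qed.

Lemma eig_spaces_direct i : (U i :&: \sum_(j | j != i) U j)%MS = 0.
Proof.
apply: (mxdirect_sumsP (P := predT) _ i isT).
by apply: (@mxdirect_sum_kermx _ _ _ _ predT) => j k _ _; apply: coprimep_eig_poly.
Qed.

Lemma eig_spaces_ind (Q : 'rV[algC]_n.+1 -> Prop) :
  Q 0 -> (forall u v, Q u -> Q v -> Q (u + v)) ->
  (forall i u, (u <= U i)%MS -> Q u) -> forall u, Q u.
Proof.
move=> Q0 QD QU u.
have /sub_sumsmxP[w ->] : (u <= \sum_i U i)%MS.
  by apply: submx_trans eig_spaces_full; apply: submx1.
by apply: big_ind => // i _; apply: (QU i); apply: submxMl.
Qed.

(** By Bezout, [eig_poly i] is the sum of a multiple of [('X - (a i)%:P) ^+ m] and a multiple of the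
    product of all [eig_poly j]; both annihilate [w]. *)
Lemma generalized_eigen_sub m i (w : 'rV_n.+1) :
  w *m (A - (a i)%:M) ^+ m = 0 -> (w <= U i)%MS.
Proof.
move=> wi; apply/sub_kermxP.
set p := \prod_(j | j != i) eig_poly j.
have cop : coprimep (('X - (a i)%:P) ^+ m) p.
  rewrite /p; elim/big_rec: _ => [|j q ji cq]; first exact: coprimep1.
  rewrite coprimepMr cq andbT; apply/coprimep_expl/coprimep_expr/coprimep_XsubC2.
  by rewrite subr_eq0 (inj_eq a_inj).
have /Bezout_eq1_coprimepP[[b c] /= bc] := cop.
rewrite -[eig_poly i]mul1r -bc mulrDl -[c * _ * _]mulrA [p * _]mulrC.
rewrite [X in c * X](_ : _ = \prod_j eig_poly j); last by rewrite (bigD1 i).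
rewrite rmorphD [X in _ + X]rmorphM /= eig_poly_annihilates mulr0 addr0.
by rewrite [b * _]mulrC -mulrA rmorphM /= horner_XsubC_exp mulmxA wi mul0mx.
Qed.

Lemma not_eigen_eq0 m z (w : 'rV_n.+1) :
  (forall i, a i != z) -> w *m (A - z%:M) ^+ m = 0 -> w = 0.
Proof.
move=> az wz; have zne : A - z%:M \in unitmx.
  have := aE z; rewrite /eigenvalue /eigenspace kermx_eq0 row_free_unit.
  by case: (_ \in _) => // /esym/existsP[i /eqP zi]; have := az i; rewrite zi eqxx.
elim: m wz => [|m IH]; first by rewrite mulmx1.
by rewrite exprSr mulmxA => /(congr1 (mulmx^~ (invmx (A - z%:M)))); rewrite mulmxK // mul0mx.
Qed.

Variable t : 'I_r -> rat.
Hypothesis tD : forall i j k, a i * a j = a k -> t i + t j = t k.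

Definition eig_proj i := proj_mx (U i) (\sum_(j | j != i) U j)%MS.

Definition weight_derivation : 'M[algC]_n.+1 := \sum_i ratr (t i) *: eig_proj i.

Lemma eig_projE m i j (w : 'M[algC]_(m, n.+1)) :
  (w <= U i)%MS -> w *m eig_proj j = if i == j then w else 0.
Proof.
move=> wi; case: eqP => [<-|/eqP ij]; first exact: (proj_mx_id (eig_spaces_direct i)).
apply: (proj_mx_0 (eig_spaces_direct j)); apply: submx_trans wi _.
exact: (sumsmx_sup i).
Qed.

Lemma weight_derivationE m i (w : 'M[algC]_(m, n.+1)) :
  (w <= U i)%MS -> w *m weight_derivation = ratr (t i) *: w.
Proof.
move=> wi; rewrite mulmx_sumr (bigD1 i) //= -scalemxAr (eig_projE _ wi) eqxx.
rewrite big1 ?addr0 // => j ji.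
by rewrite -scalemxAr (eig_projE _ wi) eq_sym (negPf ji) scaler0.
Qed.

(** By bilinearity generalized eigenvectors suffice. The bracket of weights [a i] and [a j] belongs
    to [a i * a j]: if that is some [a k], then [tD] applies; otherwise the bracket is 0. *)
Lemma weight_derivationP u v :
  B u v *m weight_derivation = B (u *m weight_derivation) v + B u (v *m weight_derivation).
Proof.
move: u; apply: eig_spaces_ind => [|u u' IHu IHu'|i u ui].
- by rewrite mul0mx !(bil0l Bl) mul0mx addr0.
- by rewrite mulmxDl !(bilDl Bl) mulmxDl IHu IHu' addrACA.
move: v; apply: eig_spaces_ind => [|v v' IHv IHv'|j v vj].
- by rewrite mul0mx !(bil0r Br) mul0mx addr0.
- by rewrite [in RHS]mulmxDl !(bilDr Br) mulmxDl IHv IHv' addrACA.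
rewrite (weight_derivationE ui) (weight_derivationE vj) (bilZl Bl) (bilZr Br) -scalerDl -rmorphD.
have uv : B u v *m (A - (a i * a j)%:M) ^+ (n.+1 + n.+1) = 0.
  by apply: bil_generalized_eigen; rewrite -horner_XsubC_exp; apply/sub_kermxP.
case: (pickP (fun k => a k == a i * a j)) => [k /eqP ak|ak].
  rewrite (tD (esym ak)) -ak in uv *; apply: weight_derivationE.
  exact: generalized_eigen_sub uv.
by rewrite (not_eigen_eq0 _ uv) ?mul0mx ?scaler0 // => k; rewrite ak.
Qed.

Lemma weight_derivation_sqr :
  \tr (weight_derivation *m weight_derivation) =
  ratr (\sum_i (t i) ^+ 2 * (\rank (eig_proj i))%:R).
Proof.
have Pi i : (eig_proj i <= U i)%MS by rewrite -[eig_proj i]mul1mx proj_mx_sub.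
rewrite {1}/weight_derivation mulmx_suml raddf_sum rmorph_sum /=; apply: eq_bigr => i _.
rewrite -scalemxAl (weight_derivationE (Pi i)) !mxtraceZ mulrA.
by rewrite mxtrace_idempotent ?(eig_projE _ (Pi i)) ?eqxx // rmorphM rmorph_nat rmorphXn.
Qed.

(** The trace is a sum of rational squares weighted by ranks, and these ranks are nonzero because
    each [a i] has an eigenvector. *)
Lemma weight_eq0 : \tr (weight_derivation *m weight_derivation) = 0 -> forall i, t i = 0.
Proof.
rewrite weight_derivation_sqr => /eqP; rewrite fmorph_eq0 psumr_eq0 => [|i _]; last first.
  by rewrite mulr_ge0 ?sqr_ge0 ?ler0n.
move=> /allP t0 i; have := t0 i (mem_index_enum i).
rewrite mulf_eq0 sqrf_eq0 pnatr_eq0 mxrank_eq0 => /orP[/eqP //|/eqP Pi0].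
have : eigenvalue A (a i) by rewrite aE; apply/existsP; exists i.
case/eigenvalueP => v vA /eqP[].
have vi : (v <= U i)%MS.
  by apply: (@generalized_eigen_sub 1%N); rewrite expr1 mulmxBr vA mul_mx_scalar subrr.
by have := eig_projE i vi; rewrite Pi0 mulmx0 eqxx.
Qed.

End WeightDerivation.

(** * Multiplicative relations between eigenvalues *)

Section MultiplicativeRelations.
Variables (r : nat) (a : 'I_r -> algC).
Hypothesis a_neq0 : forall i, a i != 0.

Let T : finType := ('I_r * 'I_r * 'I_r)%type.

(** The exponent vector e_i + e_j - e_k of a relation [a i * a j = a k]; other triples get the zero
    vector, so that all triples index the rows of one matrix. *)
Definition relation_exponent (x : T) (j : 'I_r) : int :=
  if a x.1.1 * a x.1.2 == a x.2 then
    (x.1.1 == j)%:Z + (x.1.2 == j)%:Z - (x.2 == j)%:Z else 0.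

Lemma prod_indicator i : \prod_j a j ^ (i == j)%:Z = a i.
Proof.
rewrite (bigD1 i) //= eqxx expr1z big1 ?mulr1 // => j ji.
by rewrite eq_sym (negPf ji) expr0z.
Qed.

Lemma prod_relation x : \prod_j a j ^ relation_exponent x j = 1.
Proof.
rewrite /relation_exponent; case: eqP => [ax|_]; last by rewrite big1.
have -> : \prod_j a j ^ ((x.1.1 == j)%:Z + (x.1.2 == j)%:Z - (x.2 == j)%:Z) =
    (\prod_j a j ^ (x.1.1 == j)%:Z) * (\prod_j a j ^ (x.1.2 == j)%:Z) *
    (\prod_j a j ^ (x.2 == j)%:Z)^-1.
  rewrite -prodfV -!big_split /=; apply: eq_bigr => j _.
  by rewrite !expfzDr // invr_expz.
by rewrite !prod_indicator ax mulfV.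
Qed.

Lemma common_denominator m n (M : 'M[rat]_(m, n)) :
  exists2 N : nat, (0 < N)%N &
    exists Z : 'M[int]_(m, n), map_mx intr Z = N%:R *: M.
Proof.
pose d := \prod_ij denq (M ij.1 ij.2).
have d0 : 0 < d by apply: prodr_gt0.
exists `|d|%N; first by rewrite absz_gt0 gt_eqF.
exists (\matrix_(i, j) (numq (M i j) * \prod_(ij | ij != (i, j)) denq (M ij.1 ij.2))).
apply/matrixP => i j; rewrite !mxE pmulrn gtz0_abs // /d [in RHS](bigD1 (i, j)) //=.
by rewrite !rmorphM /= mulrAC [_ * M i j]mulrC -numqE.
Qed.

(* If the additive relations [t i + t j = t k] mirroring [a i * a j = a k]
   force [t = 0], the relation vectors span [rat^r], so a multiple of each
   basis vector is an integral combination of them. *)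
Lemma torsion_of_relations :
  (forall t : 'I_r -> rat,
     (forall i j k, a i * a j = a k -> t i + t j = t k) -> forall i, t i = 0) ->
  exists2 N : nat, (0 < N)%N & forall i, a i ^+ N = 1.
Proof.
move=> t0.
pose S : 'M[rat]_(#|T|, r) := \matrix_(x, j) (relation_exponent (enum_val x) j)%:~R.
have /row_fullP[S' S'S] : row_full S.
  (* Each column of the cokernel matrix satisfies the additive relations, hence is 0, so the rows of
     [S] span. *)
  have : cokermx S = 0.
    apply/matrixP => i l; rewrite [RHS]mxE.
    apply: (t0 (fun i => cokermx S i l)) => {}i j k ijk.
    have := mulmx_coker S => /matrixP /(_ (enum_rank ((i, j), k)) l).
    rewrite mxE [RHS]mxE.
    under eq_bigr => p _ do rewrite mxE enum_rankK /relation_exponent /= ijk eqxx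
      rmorphB rmorphD /= mulrBl mulrDl.
    rewrite sumrB big_split /=.
    have ind q : \sum_p (q == p)%:Z%:~R * cokermx S p l = cokermx S q l.
      rewrite (bigD1 q) //= eqxx mul1r big1 ?addr0 // => p pq.
      by rewrite eq_sym (negPf pq) mul0r.
    by rewrite !ind => /subr0_eq.
  move/eqP; rewrite -mxrank_eq0 mxrank_coker subn_eq0 /row_full => h.
  by rewrite eqn_leq rank_leq_col.
have [N N0 [Z ZE]] := common_denominator S'.
exists N => // i.
(* Clearing denominators, [N] times a basis vector is an integral combination of relation
   vectors. *)
have ZS j : (i == j)%:Z * N%:Z = \sum_x Z i x * relation_exponent (enum_val x) j.
  apply: (@intr_inj rat); rewrite rmorph_sum rmorphM /=.
  have /matrixP/(_ i j) : map_mx intr Z *m S = N%:R *: 1%:M by rewrite ZE -scalemxAl S'S.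
  rewrite !mxE mulrC => <-.
  by apply: eq_bigr => x _; rewrite !mxE rmorphM.
have expM n b : b != 0 -> forall e : int, (b ^ e) ^+ n = b ^ (e * n%:Z) :> algC.
  by move=> b0 e; rewrite exprnP exprz_exp.
rewrite -(prod_indicator i) -prodrXl.
under eq_bigr => j _ do rewrite expM // ZS.
(* Thus [a i ^+ N] is a product of integral powers of relations, each evaluating to 1. *)
transitivity (\prod_x (\prod_j a j ^ relation_exponent (enum_val x) j) ^ Z i x).
  have prodz (I : finType) b (e : I -> int) : b != 0 :> algC -> b ^ (\sum_k e k) = \prod_k b ^ e k.
    by move=> b0; apply: (big_morph (fun z => b ^ z)) => // z z'; rewrite expfzDr.
  have zprod z (E : 'I_r -> algC) : (\prod_k E k) ^ z = \prod_k E k ^ z.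
    by apply: (big_morph (fun b => b ^ z)) => [b b'|]; rewrite ?expfzMl ?exp1rz.
  under [RHS]eq_bigr => x _ do rewrite zprod.
  rewrite [RHS]exchange_big /=; apply: eq_bigr => j _; rewrite prodz //.
  by apply: eq_bigr => x _; rewrite exprz_exp mulrC.
by rewrite big1 // => x _; rewrite prod_relation exp1rz.
Qed.
End MultiplicativeRelations.

(** * Quasi-unipotence of automorphisms when all derivations are nilpotent *)

Section QuasiUnipotent.
Variables (n : nat) (B : 'rV[rat]_n.+1 -> 'rV[rat]_n.+1 -> 'rV[rat]_n.+1).
Hypothesis Bl : forall a x y z, B (a *: x + y) z = a *: B x z + B y z.
Hypothesis Br : forall a x y z, B z (a *: x + y) = a *: B z x + B z y.
Hypothesis B_nil : forall D : 'M[rat]_n.+1,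
  (forall u v, B u v *m D = B (u *m D) v + B u (v *m D)) ->
  exists k, D ^+ k = 0.

Local Notation cx := (map_mx (@ratr algC)).

(** The scalar extension of [B] to [algC], written with structure constants in the standard
    basis. *)
Definition complexified (u v : 'rV[algC]_n.+1) : 'rV[algC]_n.+1 :=
  \sum_i \sum_j (u 0 i * v 0 j) *: cx (B (delta_mx 0 i) (delta_mx 0 j)).

Local Notation BC := complexified.

Lemma complexified_linl a x y z : BC (a *: x + y) z = a *: BC x z + BC y z.
Proof.
rewrite scaler_sumr -big_split; apply: eq_bigr => i _ /=.
rewrite scaler_sumr -big_split; apply: eq_bigr => j _ /=.
by rewrite !mxE mulrDl scalerDl scalerA mulrA.
Qed.

Lemma complexified_linr a x y z : BC z (a *: x + y) = a *: BC z x + BC z y.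
Proof.
rewrite scaler_sumr -big_split; apply: eq_bigr => i _ /=.
rewrite scaler_sumr -big_split; apply: eq_bigr => j _ /=.
by rewrite !mxE mulrDr scalerDl scalerA mulrCA.
Qed.

Lemma complexified_map u v : BC (cx u) (cx v) = cx (B u v).
Proof.
rewrite {2}[u]row_sum_delta {2}[v]row_sum_delta (bil_suml Bl) raddf_sum /=.
apply: eq_bigr => i _; rewrite (bil_sumr Br) raddf_sum /=; apply: eq_bigr => j _.
by rewrite (bilZl Bl) (bilZr Br) !map_mxZ scalerA !mxE.
Qed.

Lemma bilinear_ext (f g : 'rV[algC]_n.+1 -> 'rV[algC]_n.+1 -> 'rV[algC]_n.+1) :
  (forall a x y z, f (a *: x + y) z = a *: f x z + f y z) ->
  (forall a x y z, f z (a *: x + y) = a *: f z x + f z y) ->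
  (forall a x y z, g (a *: x + y) z = a *: g x z + g y z) ->
  (forall a x y z, g z (a *: x + y) = a *: g z x + g z y) ->
  (forall u v : 'rV[rat]_n.+1, f (cx u) (cx v) = g (cx u) (cx v)) -> forall u v, f u v = g u v.
Proof.
move=> fl fr gl gr fg u v; rewrite [u]row_sum_delta [v]row_sum_delta.
rewrite (bil_suml fl) (bil_suml gl); apply: eq_bigr => i _.
rewrite (bilZl fl) (bilZl gl) (bil_sumr fr) (bil_sumr gr); congr (_ *: _).
apply: eq_bigr => j _; rewrite (bilZr fr) (bilZr gr); congr (_ *: _).
by have := fg (delta_mx 0 i) (delta_mx 0 j); rewrite !map_delta_mx.
Qed.

(* Writing [D] over a rational basis of the span of its entries exhibits it as
   a complex combination of rational derivations. *)
Lemma derivation_sqr_trace0 (D : 'M[algC]_n.+1) :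
  (forall u v, BC u v *m D = BC (u *m D) v + BC u (v *m D)) -> \tr (D *m D) = 0.
Proof.
move=> Dder.
have [m [T [Tlin Tinj TX _]]] := rat_coordinates (V := algC^o)
   [seq D ij.1 ij.2 | ij : 'I_n.+1 * 'I_n.+1].
have TDij i j : exists u, T u = D i j by apply/TX/mapP; exists (i, j); rewrite ?mem_enum.
pose w i j := projT1 (cid (TDij i j)).
have wE i j : T (w i j) = D i j := projT2 (cid (TDij i j)).
have T0 := rat_linear0 Tlin; have TD := rat_linearD Tlin.
have TZ := rat_linearZ Tlin.
pose s k := T (delta_mx 0 k).
have TE u : T u = \sum_k s k * ratr (u 0 k).
  rewrite [u in LHS]row_sum_delta (big_morph T TD T0).
  by apply: eq_bigr => k _; rewrite TZ mulrC.
pose Dk k : 'M[rat]_n.+1 := \matrix_(i, j) w i j 0 k.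
have DE : D = \sum_k s k *: cx (Dk k).
  apply/matrixP => i j; rewrite -wE TE summxE.
  by apply: eq_bigr => k _; rewrite !mxE.
(* The [s k] are linearly independent over [rat], because [T] is injective. *)
have indep (x : 'I_m -> 'rV[rat]_n.+1) : \sum_k s k *: cx (x k) = 0 -> forall k, x k = 0.
  move=> x0 k; apply/rowP => l; rewrite [RHS]mxE.
  have : T (\row_k x k 0 l) = T 0.
    rewrite T0 TE; move/matrixP/(_ 0 l): x0; rewrite summxE mxE => {2}<-.
    by apply: eq_bigr => k' _; rewrite !mxE.
  by move/Tinj/matrixP/(_ 0 k); rewrite !mxE.
have mulD (u : 'rV_n.+1) : cx u *m D = \sum_k s k *: cx (u *m Dk k).
  by rewrite DE mulmx_sumr; apply: eq_bigr => k _; rewrite -scalemxAr map_mxM.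
(* Comparing coefficients of the [s k] in the derivation rule for [D] gives the rule for each
   [Dk k]. *)
have Dk_der k u v : B u v *m Dk k = B (u *m Dk k) v + B u (v *m Dk k).
  apply/subr0_eq; move: k; apply: indep.
  have := Dder (cx u) (cx v); rewrite complexified_map !mulD.
  rewrite (bil_suml complexified_linl) (bil_sumr complexified_linr) -big_split /=.
  move/eqP; rewrite -subr_eq0 -sumrB => /eqP {2}<-.
  apply: eq_bigr => k _; rewrite (bilZl complexified_linl) (bilZr complexified_linr).
  by rewrite !complexified_map map_mxB map_mxD scalerBr scalerDr.
have nil_tr (E : 'M[rat]_n.+1) :
    (forall u v, B u v *m E = B (u *m E) v + B u (v *m E)) -> \tr (E *m E) = 0.
  move=> /B_nil[k Ek]; apply/eqP; rewrite -(fmorph_eq0 (@ratr algC)) -trace_map_mx.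
  apply/eqP/(@mxtrace_nilpotent _ _ k); rewrite map_mxM mulmxE -expr2 -exprM mulnC exprM.
  by rewrite -rmorphXn /= Ek rmorph0 expr0n.
(* Polarization: the squares of [Dk k], of [Dk l] and of their sum all have trace 0. *)
have trDk k l : \tr (Dk k *m Dk l) = 0.
  have der : forall u v, B u v *m (Dk k + Dk l) =
      B (u *m (Dk k + Dk l)) v + B u (v *m (Dk k + Dk l)).
    move=> u v; rewrite !mulmxDr !Dk_der.
    by rewrite (bilDl Bl) (bilDr Br) addrACA.
  have := nil_tr _ der; rewrite mulmxDl !mulmxDr !raddfD /= !nil_tr //.
  rewrite add0r addr0 [\tr (Dk l *m _)]mxtrace_mulC => /eqP.
  by rewrite -mulr2n mulrn_eq0 => /eqP.
rewrite DE mulmx_suml raddf_sum big1 //= => k _; rewrite mulmx_sumr raddf_sum big1 //= => l _.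
by rewrite -scalemxAl -scalemxAr !mxtraceZ -map_mxM trace_map_mx trDk rmorph0 !mulr0.
Qed.

Variable A : 'M[rat]_n.+1.
Hypothesis A_unit : A \in unitmx.
Hypothesis BA : forall u v, B (u *m A) (v *m A) = B u v *m A.

Lemma complexified_morph u v : BC (u *m cx A) (v *m cx A) = BC u v *m cx A.
Proof.
apply: (bilinear_ext (f := fun u v => BC (u *m cx A) (v *m cx A))
  (g := fun u v => BC u v *m cx A)) => [a x y z|a x y z|a x y z|a x y z|{}u {}v].
- by rewrite mulmxDl -scalemxAl complexified_linl.
- by rewrite mulmxDl -scalemxAl complexified_linr.
- by rewrite complexified_linl mulmxDl -scalemxAl.
- by rewrite complexified_linr mulmxDl -scalemxAl.
- by rewrite -!map_mxM !complexified_map -map_mxM BA.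
Qed.

(** Every additive weight vanishes, since the square of its derivation has trace 0; hence the
    eigenvalues are roots of unity with a common exponent [N]. *)
Theorem quasi_unipotent : exists2 N : nat, (0 < N)%N & exists m, (A ^+ N - 1) ^+ m = 0.
Proof.
have [rs rsE] := char_poly_split (cx A).
pose es := undup rs.
pose a (i : 'I_(size es)) := es`_i.
have a_inj : injective a.
  by move=> i j /eqP; rewrite nth_uniq ?undup_uniq // => /eqP/val_inj.
have aE z : eigenvalue (cx A) z = [exists i, a i == z].
  rewrite eigenvalue_root_char rsE root_prod_XsubC -mem_undup -/es.
  apply/idP/existsP => [/(nthP 0)[i ilt <-]|[i /eqP <-]]; last exact: mem_nth.
  by exists (Ordinal ilt); rewrite /a.
have a_neq0 i : a i != 0.
  apply/eqP => ai0; have : eigenvalue (cx A) 0.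
    by rewrite aE; apply/existsP; exists i; rewrite ai0.
  case/eigenvalueP => v vA /eqP[]; move: vA; rewrite scale0r => vA.
  have Au : cx A \in unitmx by rewrite map_unitmx.
  by rewrite -[v](mulmxK Au) vA mul0mx.
have [t trel|N N0 aN] := torsion_of_relations a_neq0.
  apply: (weight_eq0 a_inj aE).
  apply: derivation_sqr_trace0 => u v.
  exact: (weight_derivationP complexified_linl complexified_linr complexified_morph a_inj aE trel).
exists N => //; exists n.+1.
apply: (map_mx_inj (f := @ratr algC)).
rewrite rmorph0 rmorphXn rmorphB rmorphXn rmorph1 /=.
(* Each eigenvalue is a root of ['X^N - 1], and the exponent [n.+1] matches the one in
   [eig_poly]. *)
have dvd : \prod_i eig_poly n a i %| ('X^N - 1) ^+ n.+1.
  rewrite /eig_poly prodrXl; apply: dvdp_exp2r.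
  have -> : \prod_i ('X - (a i)%:P) = \prod_(z <- [seq a i | i <- enum 'I_(size es)]) ('X - z%:P).
    by rewrite big_map big_enum.
  apply: uniq_roots_dvdp.
    apply/allP => z /mapP[i _ ->]; by rewrite /root !hornerE aN subrr.
  by rewrite uniq_rootsE map_inj_uniq ?enum_uniq.
have <- : horner_mx (cx A) (('X^N - 1) ^+ n.+1) = (cx A ^+ N - 1) ^+ n.+1.
  by rewrite rmorphXn rmorphB rmorphXn rmorph1 /= horner_mx_X.
have /dvdpP[q ->] := dvd.
by rewrite rmorphM /= (eig_poly_annihilates a_inj aE) mulr0.
Qed.

End QuasiUnipotent.

(** * Automorphisms of characteristically nilpotent Lie algebras *)

Section UnipotentPower.
Variables (R : realType) (V : lmodType R) (br : V -> V -> V).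
Hypothesis brP : is_lie_bracket br.
Variables (L : set V) (X : seq V).
Hypothesis Lsub : rat_subspace L.
Hypothesis XL : forall x, x \in X -> L x.
Hypothesis Lmin : forall P : set V, rat_subspace P -> (forall x, x \in X -> P x) -> L `<=` P.
Hypothesis Lbr : forall x y, L x -> L y -> L (br x y).
Hypothesis Lnil : characteristically_nilpotent br L.
Variable phi : V -> V.
Hypothesis phiL : forall x, L x -> L (phi x).
Hypothesis phi_lin : forall q x y, L x -> L y ->
  phi (ratr q *: x + y) = ratr q *: phi x + phi y.
Hypothesis phi_inj : forall x, L x -> phi x = 0 -> x = 0.
Hypothesis phi_br : forall x y, L x -> L y -> phi (br x y) = br (phi x) (phi y).

(** Rational coordinates turn [L] into row vectors and [phi] into an invertible matrix, to which
    [quasi_unipotent] applies. *)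
Lemma unipotent_power : exists2 N : nat, (0 < N)%N &
  exists m, forall x, L x -> iter m (fun y => iter N phi y - y) x = 0.
Proof.
have [d [T [Tlin Tinj TX Tmin]]] := rat_coordinates X.
have TL u : L (T u) by apply: Tmin.
have T0 := rat_linear0 Tlin; have TD := rat_linearD Tlin.
have TZ := rat_linearZ Tlin; have TB := rat_linearB Tlin.
have LT x : L x -> exists u, T u = x.
  apply: (Lmin (P := [set x | exists u, T u = x])) => //; split=> /= [|q _ _ [u <-] [v <-]].
    by exists 0.
  by exists (q *: u + v).
(* [coord] inverts [T] on [L]; elsewhere it takes the default value 0. *)
pose coord x := if pselect (exists u, T u = x) is left e then projT1 (cid e) else 0.
have coordK x : L x -> T (coord x) = x.
  by rewrite /coord => /LT Tx; case: pselect => // e; apply: (projT2 (cid e)).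
have TK u : coord (T u) = u by apply: Tinj; rewrite coordK.
case: d => [|n] in T Tlin Tinj TX Tmin TL T0 TD TZ TB LT coord coordK TK *.
  exists 1%N => //; exists 0%N => x /LT[u <-] /=.
  by rewrite (_ : u = 0) ?T0 //; apply/rowP => -[].
pose B u v := coord (br (T u) (T v)).
have BE u v : T (B u v) = br (T u) (T v) by rewrite coordK //; apply: Lbr.
have Bl a x y z : B (a *: x + y) z = a *: B x z + B y z.
  by apply: Tinj; rewrite Tlin !BE Tlin (brDl brP) (brZl brP).
have Br a x y z : B z (a *: x + y) = a *: B z x + B z y.
  by apply: Tinj; rewrite Tlin !BE Tlin (brDr brP) (brZr brP).
have phi0 : phi 0 = 0.
  have L0 := rat_subspace0 Lsub; have := phi_lin 1 L0 L0.
  by rewrite rmorph1 !scale1r addr0 => h; apply: (addrI (phi 0)); rewrite -h addr0.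
have phi_sum (I : Type) (r : seq I) (q : I -> rat) (E : I -> V) : (forall i, L (E i)) ->
    phi (\sum_(i <- r) ratr (q i) *: E i) = \sum_(i <- r) ratr (q i) *: phi (E i).
  move=> LE; elim: r => [|i r IH]; first by rewrite !big_nil.
  rewrite !big_cons phi_lin // ?IH //.
  by apply: rat_subspace_sum => // j _; apply: rat_subspaceZ.
pose A : 'M[rat]_n.+1 := \matrix_i coord (phi (T (delta_mx 0 i))).
have AE u : T (u *m A) = phi (T u).
  rewrite mulmx_sum_row (big_morph T TD T0) [u in RHS]row_sum_delta (big_morph T TD T0).
  under [in RHS]eq_bigr => i _ do rewrite TZ.
  rewrite phi_sum //; apply: eq_bigr => i _.
  by rewrite TZ rowK coordK //; apply: phiL.
have Aunit : A \in unitmx.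
  rewrite -row_free_unit; apply: inj_row_free => v vA.
  by apply: Tinj; rewrite T0; apply: phi_inj => //; rewrite -AE vA T0.
have BA u v : B (u *m A) (v *m A) = B u v *m A.
  by apply: Tinj; rewrite AE !BE !AE phi_br.
(* A matrix derivation acts on [L] through [coord]; its nilpotency there is read off on the basis
   vectors. *)
have B_nil (D : 'M[rat]_n.+1) :
    (forall u v, B u v *m D = B (u *m D) v + B u (v *m D)) -> exists k, D ^+ k = 0.
  move=> Dder; have [|k Dk] := Lnil (D := fun x => T (coord x *m D)).
    split=> [x _|x y Lx Ly|q x Lx|x y Lx Ly].
    - exact: TL.
    - rewrite /= -TD -mulmxDl; congr (T (_ *m _)).
      by apply: Tinj; rewrite TD !coordK //; apply: rat_subspaceD.
    - rewrite /= -TZ scalemxAl; congr (T (_ *m _)).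
      by apply: Tinj; rewrite TZ !coordK //; apply: rat_subspaceZ.
    - rewrite /= -[in RHS](coordK x Lx) -[in RHS](coordK y Ly) !TK -!BE -TD -Dder.
      by congr (T (_ *m _)); apply: Tinj; rewrite BE !coordK //; apply: Lbr.
  exists k; apply/row_matrixP => i; rewrite rowE row0; apply: Tinj; rewrite T0.
  have <- := Dk _ (TL (delta_mx 0 i)).
  elim: k {Dk} => [|k IH]; first by rewrite mulmx1.
  by rewrite iterS -IH TK exprSr mulmxA.
have [N N0 [m Am]] := quasi_unipotent Bl Br B_nil Aunit BA.
exists N => //; exists m => x /LT[u <-].
have ANE k v : iter k phi (T v) = T (v *m A ^+ k).
  by elim: k => [|k IH]; rewrite ?mulmx1 // iterS IH -AE exprSr mulmxA.
have -> : iter m (fun y => iter N phi y - y) (T u) = T (u *m (A ^+ N - 1) ^+ m).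
  elim: m {Am} => [|m IH]; first by rewrite mulmx1.
  by rewrite iterS IH ANE exprSr mulmxA [in RHS]mulmxBr mulmx1 TB.
by rewrite Am mulmx0 T0.
Qed.

End UnipotentPower.

(** * The product Lie algebra *)

Section GraphBracket.
Variables (F : fieldType).

(** [bch] is a linear combination of iterated brackets. Applied to the two projections, this
    computes [bch] in a product componentwise. *)
Lemma bch_linear (V W : lmodType F) (brV : V -> V -> V) (brW : W -> W -> W)
    (f : {linear W -> V}) c x y :
  (forall x y, f (brW x y) = brV (f x) (f y)) ->
  f (bch brW c x y) = bch brV c (f x) (f y).
Proof.
move=> f_br; have fit s : f (iter_bracket brW s) = iter_bracket brV (map f s).
  by elim: s => [|a [|b s] IH] //=; rewrite ?linear0 // f_br IH.
rewrite /bch linear_sum; apply: eq_bigr => k _; rewrite linearZ /= linear_sum.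
congr (_ *: _); apply: eq_bigr => g _; rewrite linearZ /= fit map_flatten -map_comp.
by congr (_ *: iter_bracket _ (flatten _)); apply: eq_map => i /=; rewrite map_cat !map_nseq.
Qed.

Variables (V : lmodType F) (br : V -> V -> V).

Definition pair_bracket (p q : V * V) : V * V := (br p.1 q.1, br p.2 q.2).

Lemma pair_bracketP : is_lie_bracket br -> is_lie_bracket pair_bracket.
Proof.
case=> brl brr brxx jac; split=> [a x y z|a x y z|x|x y z]; apply/eqP.
- by rewrite xpair_eqE /= !brl !eqxx.
- by rewrite xpair_eqE /= !brr !eqxx.
- by rewrite xpair_eqE /= !brxx !eqxx.
- by rewrite xpair_eqE /= !jac !eqxx.
Qed.

Lemma pair_bracket_nilpotent c : lie_nilpotent br c -> lie_nilpotent pair_bracket c.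
Proof.
move=> nil s sc.
have itE t : iter_bracket pair_bracket t =
    (iter_bracket br (map fst t), iter_bracket br (map snd t)).
  elim: t => [//|a [|b t] IH]; first by case: a.
  by rewrite -[LHS]/(pair_bracket a (iter_bracket pair_bracket (b :: t))) IH.
by rewrite itE !nil ?size_map.
Qed.

Lemma bch_pair c p q :
  bch pair_bracket c p q = (bch br c p.1 q.1, bch br c p.2 q.2).
Proof.
rewrite [LHS]surjective_pairing; congr (_, _).
  exact: (@bch_linear _ _ _ _ fst).
exact: (@bch_linear _ _ _ _ snd).
Qed.

End GraphBracket.

(** * The extension of an endomorphism to the Lie algebra *)

Section FiniteSpan.
Variables (R : realType) (V : lmodType R) (br : V -> V -> V).
Hypothesis brP : is_lie_bracket br.
Variable c : nat.
Hypothesis br_nilp : lie_nilpotent br c.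

Fixpoint words (E : seq V) (k : nat) : seq (seq V) :=
  if k is k'.+1 then [seq x :: w | x <- E, w <- words E k'] else [:: [::]].

Lemma words_all E s : (forall z, z \in s -> z \in E) -> s \in words E (size s).
Proof.
elim: s => // x s IH sE /=; apply: allpairs_f; first by apply: sE; rewrite mem_head.
by apply: IH => z zs; apply: sE; rewrite inE zs orbT.
Qed.

Lemma words_letter E k s : s \in words E k -> forall z, z \in s -> z \in E.
Proof.
elim: k s => [|k IH] s /=; first by rewrite inE => /eqP ->.
case/allpairsP=> -[x w] /= [xE wE ->] z; rewrite inE => /orP[/eqP -> //|].
exact: IH.
Qed.

Variables (G : groupType) (l : G -> V).
Hypothesis lM : forall g h, l (g * h)%g = bch br c (l g) (l h).
Hypothesis lV : forall g, l g^-1%g = - l g.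

(** The elements whose logarithm lies in the Lie algebra generated by the logarithms of the
    generators form a subgroup, hence all of [G]. Words longer than [c] vanish, so finitely many
    words span. *)
Lemma rat_span_log_fg : finitely_generated G ->
  exists X : seq V, (forall x, x \in X -> rat_span (range l) x) /\
    forall P, rat_subspace P -> (forall x, x \in X -> P x) -> rat_span (range l) `<=` P.
Proof.
case=> s sG; pose E := map l s.
pose W := word_span br [set` E].
have lW g : W 0 (l g).
  have /(_ [set h | W 0 (l h)]) : generated_by [set` s] g by rewrite sG.
  apply=> [|h hs]; last by apply: sub_word_span; apply: map_f.
  split=> [|x y /= Wx Wy|x /= Wx].
  - by rewrite /= (log1 brP br_nilp lM lV); apply: rat_subspace0; apply: word_span_subspace.
  - rewrite lM -[bch _ _ _ _](subrK (l x + l y + ratr 2^-1 *: br (l x) (l y))).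
    have Wxy : W 1 (br (l x) (l y)) by apply: word_span_br.
    apply: rat_subspaceD; first exact: word_span_subspace.
      exact/word_spanS/(bch_word_span brP br_nilp)/word_spanS.
    apply: rat_subspaceD; first exact: word_span_subspace.
      by apply: rat_subspaceD => //; apply: word_span_subspace.
    by apply: rat_subspaceZ; [apply: word_span_subspace | apply: word_spanS].
  - by rewrite lV; apply: rat_subspaceN => //; apply: word_span_subspace.
exists [seq iter_bracket br w | w <- flatten [seq words E k | k <- iota 0 c.+1]]; split.
  move=> _ /mapP[w /flattenP[_ /mapP[k _ ->]] wk ->].
  have wE := words_letter wk.
  case: w {wk} wE => [_|x w wE]; first by apply: rat_subspace0; apply: rat_span_subspace.
  rewrite (rat_span_logE brP br_nilp lM lV); apply: iter_bracket_word_span => // z /wE.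
  by case/mapP => g _ ->; exists g.
move=> P Psub XP; apply: rat_span_min => // _ [g _ <-].
have: W 0 (l g) by []; apply: rat_span_min => // _ [w [wE w0 ->]].
have [cw|wc] := ltnP c (size w).
  by rewrite (iter_bracket_long brP br_nilp) //; apply: rat_subspace0.
apply: XP; apply: map_f; apply/flattenP; exists (words E (size w)).
  by apply: map_f; rewrite mem_iota.
exact: words_all.
Qed.

End FiniteSpan.

(** * The graph of an injective endomorphism and its surjectivity *)

Section Malcev.
Variables (R : realType) (V : lmodType R) (br : V -> V -> V).
Hypothesis brP : is_lie_bracket br.
Variable c : nat.
Hypothesis br_nilp : lie_nilpotent br c.
Variables (G : groupType) (l : G -> V).
Hypothesis lM : forall g h, l (g * h)%g = bch br c (l g) (l h).
Hypothesis lV : forall g, l g^-1%g = - l g.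
Hypothesis l_eq0 : forall g, l g = 0 -> g = 1%g.
Variable f : group_hom G G.
Hypothesis f_inj : injective f.

Local Notation L := (rat_span (range l)).
Local Notation M := (word_span br (range l)).

(** The logarithm for [G] mapped to the product by [g |-> (g, f g)]; the rational span of its values
    will be the graph of the extension of [f]. *)
Definition graph_log g : V * V := (l g, l (f g)).
Local Notation Gamma := (rat_span (range graph_log)).

Let pbP := pair_bracketP brP.
Let pb_nilp := pair_bracket_nilpotent br_nilp.

Lemma graph_logM g h : graph_log (g * h)%g =
  bch (pair_bracket br) c (graph_log g) (graph_log h).
Proof. by rewrite bch_pair /graph_log gmulfM !lM. Qed.

Lemma graph_logV g : graph_log g^-1%g = - graph_log g.
Proof. by rewrite /graph_log gmulfV !lV. Qed.

Let l1 : l 1%g = 0. Proof. exact: (log1 brP br_nilp lM lV). Qed.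

Let GammaE := rat_span_logE pbP pb_nilp graph_logM graph_logV.

Lemma graph_log_multiple p : Gamma p ->
  exists2 k : nat, (0 < k)%N & exists g, l g = p.1 *+ k /\ l (f g) = p.2 *+ k.
Proof.
rewrite GammaE => /(word_span_log pbP pb_nilp graph_logM graph_logV)[k k0 [g gE]].
exists k => //; exists g; split.
  by rewrite -(raddfMn (@fst V V)) -gE.
by rewrite -(raddfMn (@snd V V)) -gE.
Qed.

Lemma mulrn_eq0_gt0 (x : V) k : (0 < k)%N -> x *+ k = 0 -> x = 0.
Proof.
rewrite -scaler_nat => k0 /eqP; rewrite scaler_eq0 pnatr_eq0 -leqn0 leqNgt k0.
by move=> /eqP.
Qed.

(** A positive multiple of [(0, y)] is the graph point of some [g] with [l g = 0], so [g = 1] and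
    [y = 0]. Hence [Gamma] is the graph of a map. *)
Lemma graph_functional y : Gamma (0, y) -> y = 0.
Proof.
case/graph_log_multiple=> k k0 [g [/=]]; rewrite mul0rn => /l_eq0 ->.
by rewrite gmulf1 l1 => /esym; apply: mulrn_eq0_gt0.
Qed.

(** Here [l (f g) = 0], and injectivity of [f] gives [g = 1]. *)
Lemma graph_injective x : Gamma (x, 0) -> x = 0.
Proof.
case/graph_log_multiple=> k k0 [g [/= + /[!mul0rn] /l_eq0 fg]].
have -> : g = 1%g by apply: f_inj; rewrite fg gmulf1.
by rewrite l1 => /esym; apply: mulrn_eq0_gt0.
Qed.

Lemma graph_dom x : L x -> exists y, Gamma (x, y).
Proof.
apply: (rat_span_min (P := [set x | exists y, Gamma (x, y)])) => [|_ [g _ <-] /=].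
  split=> /= [|q x1 x2 [y1 xy1] [y2 xy2]].
    by exists 0; apply: (rat_subspace0 (rat_span_subspace _)).
  by exists (ratr q *: y1 + y2); apply: ((rat_span_subspace _).2 q (x1, y1) (x2, y2)).
by exists (l (f g)); apply: sub_rat_span; exists g.
Qed.

(** The function with graph [Gamma], set to 0 outside [L]. *)
Definition malcev_map x : V :=
  if pselect (exists y, Gamma (x, y)) is left e then projT1 (cid e) else 0.
Local Notation phi := malcev_map.

Lemma malcev_mapP x : L x -> Gamma (x, phi x).
Proof.
by rewrite /phi => /graph_dom Lx; case: pselect => // e; apply: (projT2 (cid e)).
Qed.

Lemma graphL x y : Gamma (x, y) -> L x /\ L y.
Proof.
have : Gamma `<=` [set p | L p.1 /\ L p.2]; last by move=> h /h.
apply: rat_span_min => [|_ [g _ <-] /=].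
  split=> /= [|q p p' [? ?] [? ?]].
    by split; apply: rat_subspace0; apply: rat_span_subspace.
  by split; apply: (rat_span_subspace _).2.
by split; apply: sub_rat_span; [exists g | exists (f g)].
Qed.

Lemma graphE x y : Gamma (x, y) -> y = phi x.
Proof.
move=> xy; have /graphL[Lx _] := xy; apply/subr0_eq/graph_functional.
have := rat_subspaceB (rat_span_subspace _) xy (malcev_mapP Lx).
by rewrite (_ : (x, y) - (x, phi x) = (0, y - phi x)) //; congr (_, _); rewrite /= subrr.
Qed.

Lemma malcev_mapL x : L x -> L (phi x).
Proof. by move=> /malcev_mapP/graphL[]. Qed.

Lemma malcev_map_lin q x y : L x -> L y ->
  phi (ratr q *: x + y) = ratr q *: phi x + phi y.
Proof.
move=> /malcev_mapP px /malcev_mapP py; apply/esym/graphE.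
exact: ((rat_span_subspace _).2 q (x, phi x) (y, phi y)).
Qed.

Lemma malcev_map_inj x : L x -> phi x = 0 -> x = 0.
Proof. by move=> /malcev_mapP + px; rewrite px => /graph_injective. Qed.

(** [Gamma] is closed under the bracket of the product, being a word span. *)
Lemma malcev_map_br x y : L x -> L y -> phi (br x y) = br (phi x) (phi y).
Proof.
move=> /malcev_mapP px /malcev_mapP py; apply/esym/graphE.
move: px py; rewrite !GammaE => px py.
by have /word_spanS := word_span_br pbP px py.
Qed.

Lemma malcev_map_log g : phi (l g) = l (f g).
Proof. by apply/esym/graphE; apply: sub_rat_span; exists g. Qed.

Hypothesis G_fg : finitely_generated G.
Hypothesis L_char_nil : characteristically_nilpotent br L.

Let LE : L = M 0 := rat_span_logE brP br_nilp lM lV.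

(** A power [psi] of [phi] is unipotent and extends the power [F] of [f]; surjectivity of [F] is
    proved from the deepest layer upwards. *)
Lemma malcev_surjective : range f = setT.
Proof.
have Lsub := rat_span_subspace (range l).
have Msub i : rat_subspace (M i) := word_span_subspace br (range l) i.
have Lbr x y : L x -> L y -> L (br x y).
  by rewrite LE => Lx Ly; apply/word_spanS/word_span_br.
have [X [XL Lmin]] := rat_span_log_fg brP br_nilp lM lV G_fg.
have [N N0 [m Hm]] := unipotent_power brP Lsub XL Lmin Lbr L_char_nil
  malcev_mapL malcev_map_lin malcev_map_inj malcev_map_br.
pose psi := iter N phi; pose F := iter N f; pose delta y := psi y - y.
have psiL x : L x -> L (psi x).
  by rewrite /psi => Lx; elim: (N) => //= k; apply: malcev_mapL.
have psi_lin q x y : L x -> L y -> psi (ratr q *: x + y) = ratr q *: psi x + psi y.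
  move=> Lx Ly; rewrite /psi; elim: (N) => //= k ->; apply: malcev_map_lin.
    by elim: (k) => //= j; apply: malcev_mapL.
  by elim: (k) => //= j; apply: malcev_mapL.
have psi_br x y : L x -> L y -> psi (br x y) = br (psi x) (psi y).
  move=> Lx Ly; rewrite /psi; elim: (N) => //= k ->; apply: malcev_map_br.
    by elim: (k) => //= j; apply: malcev_mapL.
  by elim: (k) => //= j; apply: malcev_mapL.
have psi_log g : psi (l g) = l (F g).
  by rewrite /psi /F; elim: (N) => //= k ->; apply: malcev_map_log.
have FM g h : F (g * h)%g = (F g * F h)%g.
  by rewrite /F; elim: (N) => //= k ->; rewrite gmulfM.
have FV g : F g^-1%g = (F g)^-1%g.
  by rewrite /F; elim: (N) => //= k ->; rewrite gmulfV.
have ML i : M i `<=` L by rewrite LE; apply: word_span_le.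
have psi0 : psi 0 = 0.
  have := psi_lin 1 0 0 (rat_subspace0 Lsub) (rat_subspace0 Lsub).
  by rewrite rmorph1 !scale1r addr0 => h; apply: (addrI (psi 0)); rewrite -h addr0.
(* [psi] maps logarithms to logarithms, hence words in them to words of the same length. *)
have psiM i x : M i x -> M i (psi x).
  have : M i `<=` [set x | L x /\ M i (psi x)]; last by move=> h /h[].
  apply: rat_span_min => [|_ [s [sl si ->]]] /=.
    split=> /= [|q x1 x2 [L1 M1] [L2 M2]]; last first.
      by split; [apply: Lsub.2 | rewrite psi_lin //; apply: (Msub i).2].
    by rewrite psi0; split; apply: rat_subspace0.
  split; first by apply: (ML i); apply: iter_bracket_word_span.
  have [-> psl] : psi (iter_bracket br s) = iter_bracket br (map psi s) /\
      (forall z, z \in map psi s -> range l z).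
    split; last by move=> z /mapP[_ /sl[g _ <-] ->]; exists (F g).
    elim: s sl {si} => //= a [//|b s] IH sl.
    have sL z : z \in [:: a, b & s] -> L z by move=> /sl; apply: sub_rat_span.
    have sl' z : z \in b :: s -> range l z by move=> zs; apply: sl; rewrite inE zs orbT.
    rewrite psi_br ?IH //; first by apply: sL; rewrite mem_head.
    by apply: (ML 0%N); apply: iter_bracket_word_span.
  by apply: iter_bracket_word_span; rewrite ?size_map.
have deltaM i x : M i x -> M i (delta x) by move=> Mx; apply: rat_subspaceB => //; apply: psiM.
have delta_iterM k i x : M i x -> M i (iter k delta x).
  by move=> Mx; elim: k => //= k; apply: deltaM.
have deltaD x y : L x -> L y -> delta (x + y) = delta x + delta y.
  move=> Lx Ly; have := psi_lin 1 x y Lx Ly.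
  by rewrite /delta rmorph1 !scale1r => ->; rewrite opprD addrACA.
have delta_iterD k x y : L x -> L y -> iter k delta (x + y) = iter k delta x + iter k delta y.
  move=> Lx Ly; elim: k => //= k ->; rewrite deltaD //.
    by rewrite LE; apply: delta_iterM; rewrite -LE.
  by rewrite LE; apply: delta_iterM; rewrite -LE.
have lM0 g : M 0 (l g) by rewrite -LE; apply: sub_rat_span; exists g.
have F_surj i g : M i (l g) -> exists h, F h = g.
  have [j] := ubnP (c - i); elim: j i g => // j IHj i g; rewrite ltnS => cij Mg.
  have [ci|ic] := leqP c i.
    exists 1%g; have /l_eq0 -> := word_span_nilp brP br_nilp ci Mg.
    by rewrite /F; elim: (N) => //= k ->; rewrite gmulf1.
  have next h : M i.+1 (l h) -> exists h', F h' = h.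
    by apply: IHj; apply: leq_trans cij; rewrite ltn_sub2l.
  (* The kernels of the powers of [delta] refine the layer [M i] over
     [M i.+1], and [h^-1 * F h] lies one step deeper than [h]. *)
  have step a : forall h, M i (l h) -> M i.+1 (iter a delta (l h)) -> exists h', F h' = h.
    elim: a => [|a IHa] h Mh; first exact: next.
    rewrite iterSr => Ma.
    (* As this bracket lies in the next layer, the logarithm of [h^-1 * F h] is [delta (l h)] up to
       an error [e] in that layer. *)
    have Mbr : M i.+1 (br (l h^-1%g) (l (F h))).
      by apply: word_span_br; rewrite // -psi_log; apply: psiM.
    have := log_mul_add_mod brP br_nilp lM Mbr.
    rewrite lV -psi_log [- _ + _]addrC -/(delta (l h)).
    set e := _ - _ => Me.
    have lE : l (h^-1 * F h)%g = delta (l h) + e by rewrite /e addrC subrK.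
    have Mdh : M i (delta (l h)) by apply: deltaM.
    have [||h' h'E] := IHa (h^-1 * F h)%g.
    + by rewrite lE; apply: rat_subspaceD => //; apply: word_spanS.
    + rewrite lE delta_iterD; [|exact: (ML i)|exact: (ML i.+1)].
      by apply: rat_subspaceD => //; apply: delta_iterM.
    (* If [F h'] is [h^-1 * F h], then [h * h'^-1] is a preimage of [h]. *)
    + by exists (h * h'^-1)%g; rewrite FM FV h'E invgM invgK mulgA mulgV mul1g.
  (* The [m]-th iterate of [delta] vanishes on [L], so [a = m] covers the whole layer. *)
  by apply: (step m g Mg); rewrite Hm ?LE //; apply: rat_subspace0.
rewrite eqEsubset; split=> // g _; have [h <-] := F_surj 0%N g (lM0 g).
by rewrite /F -(prednK N0) iterS; exists (iter N.-1 f h).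
Qed.

End Malcev.

(** * The logarithm on a simply-connected nilpotent Lie group *)

Section LieGroupLog.
Variables (R : realType) (N : sc_nilpotent_lie_group R).

(** By Baker-Campbell-Hausdorff [lg_exp 0] is idempotent, and the only idempotent of a group is its
    unit. *)
Lemma lg_exp0 : lg_exp (0 : 'rV_(lg_dim N)) = 1%g.
Proof.
apply: (mulgI (lg_exp (0 : 'rV_(lg_dim N)))); rewrite mulg1 lg_exp_bch.
by rewrite (bch0x (@lg_bracketP R N) (@lg_nilpotent R N)).
Qed.

Lemma lg_logM (x y : N) :
  lg_log (x * y)%g = bch (@lg_bracket R N) (lg_class N) (lg_log x) (lg_log y).
Proof. by rewrite -{1}[x]lg_logK -{1}[y]lg_logK lg_exp_bch lg_expK. Qed.

Lemma lg_logV (x : N) : lg_log x^-1%g = - lg_log x.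
Proof.
rewrite -[RHS]lg_expK; congr lg_log; apply: (mulIg x); rewrite mulVg.
rewrite -{2}[x]lg_logK lg_exp_bch.
by rewrite (bchNx (@lg_bracketP R N) (@lg_nilpotent R N)) lg_exp0.
Qed.

Lemma lg_log_eq0 (x : N) : lg_log x = 0 -> x = 1%g.
Proof. by move=> x0; rewrite -[x]lg_logK x0 lg_exp0. Qed.

End LieGroupLog.

Theorem corollary2p1 (R : realType) (G : groupType)
    (N : sc_nilpotent_lie_group R) (iota : group_hom G N)
    (G_fg : finitely_generated G)
    (G_tf : torsion_free G)
    (G_nil : nilpotent_group G)
    (iota_inj : injective iota)
    (iota_discrete : discrete_image iota)
    (iota_cocompact : cocompact_image iota)
    (L_char_nil :
       characteristically_nilpotent (@lg_bracket R N) (malcev_lie iota)) :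
  co_hopfian G.
Proof.
(* The subgroup is the range of an injective endomorphism [f], whose surjectivity is to be shown.
   Logarithms are taken along [iota], whose injectivity makes [l g = 0] force [g = 1]. *)
move=> H _ [f [f_inj <-]].
pose l (g : G) := lg_log (iota g).
have LE : malcev_lie iota = rat_span (range l) by rewrite /malcev_lie image_comp.
apply: (@malcev_surjective _ _ _ (@lg_bracketP R N) _ (@lg_nilpotent R N) _ l).
- by move=> g h; rewrite /l gmulfM lg_logM.
- by move=> g; rewrite /l gmulfV lg_logV.
- by move=> g /lg_log_eq0 g1; apply: iota_inj; rewrite g1 gmulf1.
- exact: f_inj.
- exact: G_fg.
- by rewrite -LE.
Qed.
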